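(* Let $s$ be an integer with $1 \le s \le 2(q-1)$ and let $z \in \mathbb{C}_\infty$ with $|z|<1$ (and $z \notin A\setminus\{0\}$, i.e. $z=0$ or $0<|z|<1$). Then the following identity holds in $\mathbb{T}_s$: \[ \sum_{a \in A} \frac{\chi_1(a)\cdots\chi_s(a)}{z-a} \;=\; \frac{\tilde\pi}{e_C(\tilde\pi z)}\prod_{i=1}^s \frac{f_C(\tilde\pi z;t_i)}{\omega(t_i)} \;-\; \sum_{\substack{(\alpha_i)\in\{0,1\}^s\\ \alpha_1+\cdots+\alpha_s = s-q}} \tilde\pi \prod_{i=1}^s \frac{f_C(\tilde\pi z;t_i)^{\alpha_i}}{\omega(t_i)}, \] where the second sum is empty (hence zero) when $s<q$.
   Context: $\mathbb{F}_q$ is a finite field with $q$ elements; $A=\mathbb{F}_q[\theta]$, $K=\mathbb{F}_q(\theta)$; $K_\infty$ is the completion of $K$ for the absolute value with $|\theta|=q$, and $\mathbb{C}_\infty$ is the completion of an algebraic closure of $K_\infty$. For $s\ge1$, $\mathbb{T}_s$ is the Tate algebra of power series $\sum_{\beta\in\mathbb{N}^s} c_\beta t_1^{\beta_1}\cdots t_s^{\beta_s}$ with $c_\beta\in\mathbb{C}_\infty$ and $c_\beta\to0$ as $\beta_1+\cdots+\beta_s\to\infty$ (i.e. power series converging on the closed unit polydisc), with the Gauss norm $\max_\beta|c_\beta|$; $\mathbb{T}=\mathbb{T}_1$ in the variable $t$. $\chi_i : A\to\mathbb{F}_q[t_1,\dots,t_s]$ is the $\mathbb{F}_q$-algebra homomorphism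 with $\chi_i(\theta)=t_i$. $D_j$ denotes the product of all monic polynomials of degree $j$ in $A$ ($D_0=1$). The Carlitz exponential is $e_C(z)=\sum_{j\ge0} z^{q^j}/D_j$. Fix $\iota\in\mathbb{C}_\infty$ with $\iota^{q-1}=-\theta$; put $\tilde\pi=\iota\theta\prod_{j\ge1}(1-\theta/\theta^{q^j})^{-1}$ (so $\ker e_C=\tilde\pi A$) and $\omega(t)=\iota\prod_{j\ge0}(1-t/\theta^{q^j})^{-1}\in\mathbb{T}$ (the Anderson–Thakur function). For $z\in\mathbb{C}_\infty$, the Anderson generating function is $f_C(z;t)=\sum_{j\ge0} e_C(z/\theta^{j+1})t^j=\sum_{j\ge0}\frac{z^{q^j}}{D_j(\theta^{q^j}-t)}\in\mathbb{T}$. Empty sums are $0$, empty products are $1$. *)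

(* Defs.v *)
From HB Require Import structures.
From mathcomp Require Import all_boot all_order all_algebra.
From mathcomp Require Import reals.
From Stdlib Require Import ClassicalEpsilon.

Set Implicit Arguments. Unset Strict Implicit. Unset Printing Implicit Defensive.
Import Order.TTheory GRing.Theory Num.Theory.
Local Open Scope ring_scope.

(* C plays the role of C_infty: a field with a real valued non-archimedean
   absolute value [nrm], containing (via [inj]) the finite field F = F_q and an
   element [theta] with |theta| = q, complete, algebraically closed, and in which
   the elements algebraic over F(theta) are dense.  These axioms characterise
   C_infty up to isometric isomorphism over F(theta). *)
Section Cinfty.
Variables (F : finFieldType) (C : fieldType) (R : realType).
Variables (inj : {rmorphism F -> C}) (theta : C) (nrm : C -> R).

Definition qF : nat := #|F|.

Definition evalA (a : {poly F}) : C := (map_poly inj a).[theta].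

Definition is_nonarch_abs : Prop :=
  [/\ forall x, 0 <= nrm x,
      forall x, (nrm x == 0) = (x == 0),
      forall x y, nrm (x * y) = nrm x * nrm y &
      forall x y, nrm (x + y) <= Num.max (nrm x) (nrm y)].

Definition cvgC (u : nat -> C) (l : C) : Prop :=
  forall eps : R, 0 < eps -> exists N, forall n, (N <= n)%N -> nrm (u n - l) < eps.

Definition cauchyC (u : nat -> C) : Prop :=
  forall eps : R, 0 < eps -> exists N, forall m n, (N <= m)%N -> (N <= n)%N ->
    nrm (u m - u n) < eps.

Definition algK (x : C) : Prop :=
  exists P : {poly {poly F}}, P != 0 /\ (map_poly evalA P).[x] = 0.

Definition is_Cinfty : Prop :=
  [/\ is_nonarch_abs,
      nrm theta = (qF%:R : R),
      (forall u, cauchyC u -> exists l, cvgC u l),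
      (forall p : {poly C}, (1 < size p)%N -> exists x, root p x) &
      (forall x (eps : R), 0 < eps -> exists y, algK y /\ nrm (x - y) < eps)].

Definition limC (u : nat -> C) : C := epsilon (inhabits 0) (cvgC u).
Definition sumC (u : nat -> C) : C := limC (fun n => \sum_(i < n) u i).
Definition prodC (u : nat -> C) : C := limC (fun n => \prod_(i < n) u i).

Definition polyA (d : nat) (c : {ffun 'I_d -> F}) : {poly F} :=
  \sum_(i < d) (c i)%:P * 'X^i.

Definition Dj (j : nat) : C :=
  \prod_(c : {ffun 'I_j -> F}) evalA ('X^j + polyA c).

Definition eC (x : C) : C := sumC (fun j => x ^+ (qF ^ j)%N / Dj j).

(* tilde pi, for a chosen iota with iota^(q-1) = -theta *)
Definition pitilde (iota : C) : C :=
  iota * theta * prodC (fun j => (1 - theta / theta ^+ (qF ^ j.+1)%N)^-1).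

Definition ser1 := nat -> C.
Definition in_tate1 (f : ser1) : Prop :=
  forall eps : R, 0 < eps -> exists N, forall n, (N <= n)%N -> nrm (f n) < eps.
Definition one1 : ser1 := fun n => if n == 0%N then 1 else 0.
Definition mul1 (f g : ser1) : ser1 := fun n => \sum_(i < n.+1) f i * g (n - i)%N.
Definition scale1 (c : C) (f : ser1) : ser1 := fun n => c * f n.
Definition inv1 (f : ser1) : ser1 :=
  epsilon (inhabits one1) (fun g => in_tate1 g /\ mul1 f g = one1).
(* convergence for the Gauss norm *)
Definition cvgT1 (u : nat -> ser1) (l : ser1) : Prop :=
  forall eps : R, 0 < eps -> exists N, forall n, (N <= n)%N ->
    forall k, nrm (u n k - l k) < eps.
Definition limT1 (u : nat -> ser1) : ser1 := epsilon (inhabits one1) (cvgT1 u).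

Definition omega_fac (j : nat) : ser1 :=
  fun k => if k == 0%N then 1 else if k == 1%N then - (theta ^+ (qF ^ j)%N)^-1 else 0.

Definition omega (iota : C) : ser1 :=
  scale1 iota (limT1 (fun n => \big[mul1/one1]_(j < n) inv1 (omega_fac j))).

Definition fC (x : C) : ser1 := fun j => eC (x / theta ^+ j.+1).

Definition mon (s : nat) := {ffun 'I_s -> nat}.
Definition ser (s : nat) := mon s -> C.
Definition cvgT (s : nat) (u : nat -> ser s) (l : ser s) : Prop :=
  forall eps : R, 0 < eps -> exists N, forall n, (N <= n)%N ->
    forall b, nrm (u n b - l b) < eps.
Definition limT (s : nat) (u : nat -> ser s) : ser s :=
  epsilon (inhabits (fun _ => 0)) (cvgT u).

(* partial sum of sum_{a in A, deg a < d} chi_1(a)...chi_s(a) / (z - a);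
   the coefficient of t^b in chi_1(a)...chi_s(a) is prod_i a_{b_i} *)
Definition lhs_partial (s : nat) (z : C) (d : nat) : ser s := fun b =>
  \sum_(c : {ffun 'I_d -> F})
     inj (\prod_(i : 'I_s) (polyA c)`_(b i)) / (z - evalA (polyA c)).

Definition carlitz_lhs (s : nat) (z : C) : ser s := limT (@lhs_partial s z).

Definition fC_over_omega (iota z : C) : ser1 :=
  mul1 (fC (pitilde iota * z)) (inv1 (omega iota)).

Definition rhs1 (s : nat) (iota z : C) : ser s := fun b =>
  pitilde iota / eC (pitilde iota * z) *
  \prod_(i : 'I_s) fC_over_omega iota z (b i).

(* value at z, extended by continuity (in the Gauss norm) at z = 0,
   where the literal expression is 0/0 *)
Definition ext0 (s : nat) (G : C -> ser s) (z : C) : ser s :=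
  if z != 0 then G z else
  epsilon (inhabits (fun _ => 0)) (fun l =>
    forall eps : R, 0 < eps -> exists2 del : R, 0 < del &
      forall w, w != 0 -> nrm w < del -> forall b, nrm (G w b - l b) < eps).

Definition rhs2 (s : nat) (iota z : C) : ser s := fun b =>
  \sum_(al : {ffun 'I_s -> bool} | ((\sum_(i : 'I_s) (al i : nat)) + qF)%N == s)
    pitilde iota * \prod_(i : 'I_s)
      (if al i then fC_over_omega iota z (b i) else inv1 (omega iota) (b i)).

End Cinfty.

Arguments carlitz_lhs [F C R] inj theta nrm s z _.
Arguments rhs1 [F C R] inj theta nrm s iota z _.
Arguments rhs2 [F C R] inj theta nrm s iota z _.

(* Main.v *)
Require Import Defs.
From HB Require Import structures.
From mathcomp Require Import all_boot all_order all_algebra all_field.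
From mathcomp Require Import boolp reals.
From mathcomp Require Import ring lra zify.
Set Implicit Arguments. Unset Strict Implicit. Unset Printing Implicit Defensive.
Import Order.TTheory GRing.Theory Num.Theory.
Local Open Scope ring_scope.

(* Let e_d(X) be the product of the X - a over deg a < d, E_d = e_d/D_d, l_d = e_d',
   and let b_d(t) be the product of the t - theta^(q^i) for i < d. The partial sum
   Psi_d(z;t) = sum_(j < d) E_j(z) b_j(t) of Carlitz's interpolation series is a
   polynomial in z of degree at most q^(d-1) with Psi_d(a;t) = chi_t(a) for deg a < d.
   Hence the sum over deg a < d of prod_i chi_i(a)/(z - a) is, by Lagrange
   interpolation, l_d (P(z)/e_d(z) - Q(z)), where P = prod_i Psi_d(z;t_i) and Q is the
   quotient of P by e_d. Expanding P along Psi_(d+1) = Psi_d + E_d b_d and reducing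
   with E_d^q = E_d + e_(d+1)/D_d^q gives Q explicitly: for s <= 2(q-1), a single
   reduction brings every term below degree q^(d+1).
   As d grows, e_d(z)/l_d tends to e_C(pi z)/pi, and b_d suitably normalised tends to
   iota/omega. The limit of Psi_d is f_C(pi z)/omega, because the relation
   Psi_(d+1)(theta z) = t Psi_(d+1)(z) - E_d(z) b_(d+1) turns in the limit into the
   functional equation of f_C. The terms of Q with fewer than s - q factors Psi_d carry
   positive powers of a factor tending to 0, so that exactly the second sum of the
   theorem survives. For z = 0, both sides are Lipschitz in z, uniformly. *)

(** * Ultrametric convergence *)

Section UniformConvergence.
Variables (C : fieldType) (R : realType) (nrm : C -> R).
Hypothesis nrmP : is_nonarch_abs nrm.

Lemma nrm_ge0 x : 0 <= nrm x. Proof. by case: nrmP. Qed.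

Lemma nrm_eq0 x : (nrm x == 0) = (x == 0). Proof. by case: nrmP. Qed.

Lemma nrmM x y : nrm (x * y) = nrm x * nrm y. Proof. by case: nrmP. Qed.

Lemma nrmD x y : nrm (x + y) <= Num.max (nrm x) (nrm y).
Proof. by case: nrmP. Qed.

Lemma nrm0 : nrm 0 = 0. Proof. by apply/eqP; rewrite nrm_eq0. Qed.

Lemma nrm_gt0 x : (0 < nrm x) = (x != 0).
Proof. by rewrite lt_def nrm_ge0 andbT nrm_eq0. Qed.

Lemma nrm1 : nrm 1 = 1.
Proof.
have n1 : nrm 1 != 0 by rewrite nrm_eq0 oner_neq0.
by apply: (mulfI n1); rewrite -nrmM !mulr1.
Qed.

Lemma nrmX x n : nrm (x ^+ n) = nrm x ^+ n.
Proof. by elim: n => [|n IH]; rewrite ?nrm1 // !exprS nrmM IH. Qed.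

Lemma nrm_unity x n : (0 < n)%N -> x ^+ n = 1 -> nrm x = 1.
Proof.
move=> n0 xn; apply/eqP; rewrite -(@pexpr_eq1 _ (nrm x) n) ?nrm_ge0 //.
by rewrite -nrmX xn nrm1.
Qed.

Lemma nrmN x : nrm (- x) = nrm x.
Proof. by rewrite -mulN1r nrmM (@nrm_unity _ 2) ?mul1r ?sqrrN ?expr1n. Qed.

Lemma nrmBC x y : nrm (x - y) = nrm (y - x).
Proof. by rewrite -nrmN opprB. Qed.

Lemma nrmV x : nrm x^-1 = (nrm x)^-1.
Proof.
have [->|x0] := eqVneq x 0; first by rewrite invr0 nrm0 invr0.
have nx : nrm x != 0 by rewrite nrm_eq0.
by apply: (mulfI nx); rewrite -nrmM !divff ?nrm1.
Qed.

Lemma nrm_prod (I : Type) (r : seq I) (P : pred I) (F : I -> C) :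
  nrm (\prod_(i <- r | P i) F i) = \prod_(i <- r | P i) nrm (F i).
Proof. exact: (big_morph _ nrmM nrm1). Qed.

Lemma nrmD_le x y e : nrm x <= e -> nrm y <= e -> nrm (x + y) <= e.
Proof. by move=> xe ye; apply: le_trans (nrmD _ _) _; rewrite ge_max xe. Qed.

Lemma nrmB_le x y e : nrm x <= e -> nrm y <= e -> nrm (x - y) <= e.
Proof. by move=> xe ye; apply: nrmD_le; rewrite ?nrmN. Qed.

Lemma nrmD_lt x y e : nrm x < e -> nrm y < e -> nrm (x + y) < e.
Proof. by move=> xe ye; apply: le_lt_trans (nrmD _ _) _; rewrite gt_max xe. Qed.

Lemma nrm_chain x y w e : nrm (x - y) < e -> nrm (y - w) < e -> nrm (x - w) < e.
Proof. by move=> xy yw; rewrite -(subrKA y); apply: nrmD_lt. Qed.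

(** The isosceles property: x is the difference of x + y and y, so if both were smaller than x the
    ultrametric inequality would fail. *)
Lemma nrmD_eq x y : nrm y < nrm x -> nrm (x + y) = nrm x.
Proof.
move=> yx; apply/eqP; rewrite eq_le nrmD_le ?(ltW yx) //= leNgt.
by apply/negP => xyx; have := nrmB_le (ltW xyx) (ltW yx); rewrite addrK;
   have := nrmD (x + y) (- y); rewrite addrK nrmN le_max; case/orP; lra.
Qed.

Lemma nrmB_eq x y : nrm y < nrm x -> nrm (x - y) = nrm x.
Proof. by move=> yx; rewrite nrmD_eq ?nrmN. Qed.

Lemma nrm_sum_le (I : Type) (r : seq I) (P : pred I) (F : I -> C) e :
  0 <= e -> (forall i, P i -> nrm (F i) <= e) ->
  nrm (\sum_(i <- r | P i) F i) <= e.
Proof.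
move=> e0 Fe; elim/big_ind : _ => [|x y|//]; first by rewrite nrm0.
exact: nrmD_le.
Qed.

Lemma cvgC_unique u l m : cvgC nrm u l -> cvgC nrm u m -> l = m.
Proof.
move=> ul um; apply/eqP; rewrite -subr_eq0 -nrm_eq0 eq_le nrm_ge0 andbT leNgt.
apply/negP => lm; have [N1 h1] := ul _ lm; have [N2 h2] := um _ lm.
have := nrm_chain (e := nrm (l - m)) (x := l) (y := u (maxn N1 N2)) (w := m).
rewrite nrmBC ltxx => h; have := h (h1 _ (leq_maxl _ _)) (h2 _ (leq_maxr _ _)).
by [].
Qed.

Lemma limC_eq u l : cvgC nrm u l -> limC nrm u = l.
Proof.
move=> ul; have : cvgC nrm u (limC nrm u).
  by apply: ClassicalEpsilon.epsilon_spec; exists l.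
by move/cvgC_unique; apply.
Qed.

(* [cvgC], [cvgT1] and [cvgT] are the instances [unit], [nat], [mon s] of this
   notion; bounding the limit makes it compatible with products. *)
Definition bcvg (I : Type) (u : nat -> I -> C) (l : I -> C) : Prop :=
  (forall eps : R, 0 < eps -> exists N, forall n, (N <= n)%N ->
     forall i, nrm (u n i - l i) < eps) /\
  exists M, forall i, nrm (l i) <= M.

Section Index.
Variable I : Type.
Implicit Types (u v : nat -> I -> C) (l m : I -> C).

Lemma bcvg_pt u l i : bcvg u l -> cvgC nrm (fun n => u n i) (l i).
Proof. by move=> [ul _] e /ul[N h]; exists N => n Nn; apply: h. Qed.

Lemma bcvg_const (x : nat -> C) y : cvgC nrm x y ->
  bcvg (fun n (_ : I) => x n) (fun=> y).
Proof.
move=> xl; split; last by exists (nrm y).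
by move=> e /xl[N h]; exists N => n Nn _; apply: h.
Qed.

Lemma bcvg_cst l : (exists M, forall i, nrm (l i) <= M) -> bcvg (fun=> l) l.
Proof.
by move=> b; split=> // e e0; exists 0%N => n _ i; rewrite subrr nrm0.
Qed.

Lemma bcvg_ext u v l m : (forall n i, u n i = v n i) -> (forall i, l i = m i) ->
  bcvg u l -> bcvg v m.
Proof.
move=> uv lm [ul [M lM]]; split; last by exists M => i; rewrite -lm.
by move=> e /ul[N h]; exists N => n Nn i; rewrite -uv -lm; apply: h.
Qed.

Lemma bcvg_shift u l : bcvg u l -> bcvg (fun n => u n.+1) l.
Proof.
move=> [ul b]; split=> // e /ul[N h].
by exists N => n Nn i; apply: h; apply: leqW.
Qed.

Lemma bcvgD u v l m : bcvg u l -> bcvg v m ->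
  bcvg (fun n i => u n i + v n i) (fun i => l i + m i).
Proof.
move=> [ul [M lM]] [vm [M' mM]]; split; last first.
  exists (Num.max M M') => i; apply: le_trans (nrmD _ _) _.
  by rewrite ge_max !le_max lM mM orbT.
move=> e e0; have [N1 h1] := ul _ e0; have [N2 h2] := vm _ e0.
exists (maxn N1 N2) => n; rewrite geq_max => /andP[n1 n2] i.
by rewrite opprD addrACA; apply: nrmD_lt; auto.
Qed.

Lemma bcvgM u v l m : bcvg u l -> bcvg v m ->
  bcvg (fun n i => u n i * v n i) (fun i => l i * m i).
Proof.
move=> [ul [M0 lM0]] [vm [M1 mM1]].
pose M := Num.max 1 (Num.max M0 M1).
have M_gt0 : 0 < M by rewrite lt_max ltr01.
have lM i : nrm (l i) <= M by rewrite !le_max lM0 !orbT.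
have mM i : nrm (m i) <= M by rewrite !le_max mM1 !orbT.
split; last first.
  by exists (M * M) => i; rewrite nrmM ler_pM ?nrm_ge0.
move=> e e0; pose d := Num.min M (e / (M *+ 2)).
have M2 : 0 < M *+ 2 by rewrite mulrn_wgt0.
have d0 : 0 < d by rewrite lt_min M_gt0 divr_gt0.
have dM : M * d < e.
  apply: (@le_lt_trans _ _ (M * (e / (M *+ 2)))).
    by rewrite ler_pM2l // ge_min lexx orbT.
  rewrite mulrA ltr_pdivrMr // mulrC ltr_pM2l // mulr2n; lra.
have [N1 h1] := ul _ d0; have [N2 h2] := vm _ d0.
exists (maxn N1 N2) => n; rewrite geq_max => /andP[n1 n2] i.
have -> : u n i * v n i - l i * m i =
  u n i * (v n i - m i) + (u n i - l i) * m i by ring.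
have uM : nrm (u n i) <= M.
  rewrite -(subrK (l i) (u n i)); apply: nrmD_le => //.
  by apply: ltW; apply: lt_le_trans (h1 _ n1 i) _; rewrite ge_min lexx.
have di : nrm (v n i - m i) <= d by apply/ltW/h2.
have di' : nrm (u n i - l i) <= d by apply/ltW/h1.
apply: nrmD_lt; rewrite nrmM; apply: le_lt_trans dM; last rewrite mulrC;
  by rewrite ler_pM ?nrm_ge0.
Qed.

Lemma bcvg_sum (J : Type) (r : seq J) (P : pred J) (u : J -> nat -> I -> C)
    (l : J -> I -> C) : (forall j, P j -> bcvg (u j) (l j)) ->
  bcvg (fun n i => \sum_(j <- r | P j) u j n i)
       (fun i => \sum_(j <- r | P j) l j i).
Proof.
move=> ul; elim: r => [|j r IH].
  apply: bcvg_ext (bcvg_cst (l := fun=> 0) _); rewrite /= => *;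
    rewrite ?big_nil //; by exists 0 => i; rewrite nrm0.
have [Pj|nPj] := boolP (P j).
  by apply: bcvg_ext (bcvgD (ul _ Pj) IH) => *; rewrite big_cons Pj.
by apply: bcvg_ext IH => *; rewrite big_cons (negPf nPj).
Qed.

Lemma bcvg_prod (J : Type) (r : seq J) (P : pred J) (u : J -> nat -> I -> C)
    (l : J -> I -> C) : (forall j, P j -> bcvg (u j) (l j)) ->
  bcvg (fun n i => \prod_(j <- r | P j) u j n i)
       (fun i => \prod_(j <- r | P j) l j i).
Proof.
move=> ul; elim: r => [|j r IH].
  apply: bcvg_ext (bcvg_cst (l := fun=> 1) _); rewrite /= => *;
    rewrite ?big_nil //; by exists 1 => i; rewrite nrm1.
have [Pj|nPj] := boolP (P j).
  by apply: bcvg_ext (bcvgM (ul _ Pj) IH) => *; rewrite big_cons Pj.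
by apply: bcvg_ext IH => *; rewrite big_cons (negPf nPj).
Qed.

Lemma bcvg_comp (J : Type) (g : J -> I) u l : bcvg u l ->
  bcvg (fun n j => u n (g j)) (fun j => l (g j)).
Proof.
move=> [ul [M lM]]; split; last by exists M.
by move=> e /ul[N h]; exists N => n Nn j; apply: h.
Qed.

(** Norms stabilise: once [u n i] is closer to a nonzero [l i] than |l i|, both have the same
    norm. *)
Lemma nrm_lim_le u l M i : bcvg u l -> (forall n, nrm (u n i) <= M) ->
  nrm (l i) <= M.
Proof.
move=> [ul _] uM; rewrite leNgt; apply/negP => Ml.
have l0 : 0 < nrm (l i).
  exact: le_lt_trans (nrm_ge0 (u 0%N i)) (le_lt_trans (uM _) Ml).
have [N /(_ N (leqnn _) i)] := ul _ l0.
rewrite nrmBC => /nrmB_eq; rewrite opprB addrC subrK => e.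
by have := uM N; rewrite e leNgt Ml.
Qed.

(** Rates of convergence are measured against powers of 2, since |theta| = q is at least 2. *)
Lemma geo_small (A e : R) : 0 < e -> exists N, forall n, (N <= n)%N -> A / 2 ^+ n < e.
Proof.
move=> e0; have [A0|A0] := leP A 0.
  by exists 0%N => n _; apply: le_lt_trans e0; rewrite pmulr_lle0 // invr_gt0 exprn_gt0.
exists (Num.bound (A / e)) => n /upper_nthrootP h.
by rewrite ltr_pdivrMr ?exprn_gt0 // mulrC -ltr_pdivrMr.
Qed.

Hypothesis complete : forall x : nat -> C, cauchyC nrm x -> exists y, cvgC nrm x y.

(** Completeness gives the limit of each coordinate, and [choice] collects them. Passing through a
    term far enough for the given coordinate does not worsen the bound [e], by the ultrametric
    inequality; hence uniformity. *)
Lemma bcvg_cauchy u (M : R) : (forall n i, nrm (u n i) <= M) ->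
  (forall e, 0 < e -> exists N, forall n k, (N <= n)%N -> (N <= k)%N -> forall i,
     nrm (u n i - u k i) < e) ->
  exists l, bcvg u l.
Proof.
move=> uM uc.
have ex i : exists x, cvgC nrm (fun n => u n i) x.
  by apply: complete => e /uc[N h]; exists N => n k Nn Nk; apply: h.
have [l lP] := choice ex; exists l.
have ul : forall eps : R, 0 < eps -> exists N, forall n, (N <= n)%N ->
    forall i, nrm (u n i - l i) < eps.
  move=> e e0; have [N h] := uc _ e0; exists N => n Nn i.
  have [N' h'] := lP i _ e0.
  apply: (@nrm_chain _ (u (maxn N N') i)); first by rewrite h ?leq_maxl.
  by rewrite h' ?leq_maxr.
split=> //; exists M => i; have [|N h] := ul 1 => //.
rewrite leNgt; apply/negP => Ml.
have l0 : 0 < nrm (l i).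
  exact: le_lt_trans (nrm_ge0 (u 0%N i)) (le_lt_trans (uM _ _) Ml).
have [N' /(_ N' (leqnn _))] := lP i _ l0.
rewrite nrmBC => /nrmB_eq; rewrite opprB addrC subrK => e.
by have := uM N' i; rewrite e leNgt Ml.
Qed.

Lemma bcvg_tele u (A M : R) : (forall i, nrm (u 0%N i) <= M) ->
  (forall n i, nrm (u n.+1 i - u n i) <= A / 2 ^+ n) ->
  exists l, bcvg u l.
Proof.
move=> uM uA.
(* A negative [A] forces the index type to be empty, and all claims become vacuous. *)
have [A0|A0] := ltP A 0.
  have [||N h] := bcvg_cauchy (u := u) (M := M).
  - move=> n i; have := uA 0%N i; rewrite expr0 divr1 => /le_lt_trans/(_ A0).
    by rewrite ltNge nrm_ge0.
  - move=> e e0; exists 0%N => n k _ _ i.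
    have := uA 0%N i; rewrite expr0 divr1 => /le_lt_trans/(_ A0).
    by rewrite ltNge nrm_ge0.
  by exists N.
have dec n k : (n <= k)%N -> A / 2 ^+ k <= A / 2 ^+ n.
  move=> nk; rewrite ler_wpM2l // lef_pV2 ?posrE ?exprn_gt0 //.
  by rewrite ler_weXn2l // ler1n.
have tele n k i : nrm (u (n + k)%N i - u n i) <= A / 2 ^+ n.
  elim: k => [|k IH]; first by rewrite addn0 subrr nrm0 divr_ge0 ?exprn_ge0.
  rewrite addnS -(subrKA (u (n + k)%N i)); apply: nrmD_le IH.
  by apply: le_trans (uA _ _) _; rewrite dec ?leq_addr.
apply: (@bcvg_cauchy _ (Num.max M A)) => [n i|e /(geo_small A)[N h]].
  rewrite -(subrK (u 0%N i) (u n i)); apply: nrmD_le; rewrite le_max ?uM //.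
  by have := tele 0%N n i; rewrite add0n expr0 divr1 => ->; rewrite orbT.
exists N => n k Nn Nk i; apply: (@nrm_chain _ (u N i)).
  by rewrite -(subnKC Nn); apply: le_lt_trans (tele _ _ _) (h _ (leqnn _)).
by rewrite nrmBC -(subnKC Nk); apply: le_lt_trans (tele _ _ _) (h _ (leqnn _)).
Qed.

End Index.

Lemma limT1_eq u l : bcvg u l -> limT1 nrm u = l.
Proof.
move=> ul; apply/funext => k; apply: cvgC_unique (bcvg_pt k ul).
have : cvgT1 nrm u (limT1 nrm u).
  by apply: ClassicalEpsilon.epsilon_spec; exists l; case: ul.
by move=> h e /h[N hN]; exists N => n Nn; apply: hN.
Qed.

Lemma limT_eq s (u : nat -> ser C s) l : bcvg u l -> limT nrm u = l.
Proof.
move=> ul; apply/funext => k; apply: cvgC_unique (bcvg_pt k ul).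
have : cvgT nrm u (limT nrm u).
  by apply: ClassicalEpsilon.epsilon_spec; exists l; case: ul.
by move=> h e /h[N hN]; exists N => n Nn; apply: hN.
Qed.

Lemma cvgC_geo (u : nat -> C) (l : C) (A : R) :
  (forall n, nrm (u n - l) <= A / 2 ^+ n) -> cvgC nrm u l.
Proof.
move=> uA e /(geo_small A)[N h]; exists N => n Nn.
exact: le_lt_trans (uA _) (h _ Nn).
Qed.

Lemma bcvg_cvgC (u : nat -> C) (l : C) :
  bcvg (fun n (_ : unit) => u n) (fun=> l) -> cvgC nrm u l.
Proof. exact: (bcvg_pt tt). Qed.

(* Tannery's theorem; by the ultrametric inequality it suffices that the
   dominating sequence tends to zero. *)
Lemma tannery (w : nat -> nat -> C) (w' : nat -> C) (A : R) :
  0 <= A ->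
  (forall d i, (i <= d)%N -> nrm (w d i) <= A / 2 ^+ i) ->
  (forall i, nrm (w' i) <= A / 2 ^+ i) ->
  (forall i, cvgC nrm (fun d => w d i) (w' i)) ->
  cvgC nrm (fun d => \sum_(i < d.+1) w d i - \sum_(i < d.+1) w' i) 0.
Proof.
move=> A0 wA wA' ww' e e0.
have [N hN] := geo_small A e0.
have [K hK] : exists K, forall i, (i < N)%N -> forall d, (K <= d)%N ->
    nrm (w d i - w' i) < e.
  elim: N {hN} => [|N [K hK]]; first by exists 0%N.
  have [K' hK'] := ww' N _ e0; exists (maxn K K') => i; rewrite ltnS leq_eqVlt.
  case/orP => [/eqP->|iN] d; rewrite geq_max => /andP[Kd K'd]; first exact: hK'.
  exact: hK.
exists K => d Kd; rewrite subr0 -sumrB.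
elim/big_ind : _ => [|x y|i _]; [by rewrite nrm0|exact: nrmD_lt|].
have [iN|Ni] := ltnP i N; first exact: hK.
apply: nrmD_lt; rewrite ?nrmN; apply: le_lt_trans (hN _ Ni) => //.
by apply: wA; rewrite -ltnS.
Qed.

Lemma sumC_cvg (v : nat -> C) (A : R) :
  (forall u, cauchyC nrm u -> exists l, cvgC nrm u l) ->
  (forall n, nrm (v n) <= A / 2 ^+ n) ->
  cvgC nrm (fun n => \sum_(i < n) v i) (sumC nrm v).
Proof.
move=> complete vA.
have [|n _|l /(bcvg_pt tt) ul] := @bcvg_tele unit complete
    (fun n _ => \sum_(i < n) v i) A 0.
- by move=> _; rewrite big_ord0 nrm0.
- by rewrite big_ord_recr addrAC subrr add0r.
by rewrite /sumC (limC_eq ul).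
Qed.

End UniformConvergence.

(** * Products of linear factors in the Tate algebra *)

Section Ser1.
Variable C : fieldType.
Implicit Types f g h : ser1 C.

(** Coefficients below index [N] depend only on truncations to polynomials; this is how the monoid
    laws of [mul1] are inherited from [{poly C}]. *)
Lemma mul1_poly N f g n : (n < N)%N ->
  mul1 f g n = ((\poly_(i < N) f i) * (\poly_(i < N) g i))`_n.
Proof.
move=> nN; rewrite coefM; apply: eq_bigr => i _.
rewrite !coef_poly (leq_ltn_trans (leq_subr _ _) nN).
by rewrite (leq_ltn_trans _ nN) // -ltnS.
Qed.

Lemma mul1_polyE N f g n (p q : {poly C}) : (n < N)%N ->
  (forall i, (i < N)%N -> f i = p`_i) -> (forall i, (i < N)%N -> g i = q`_i) ->
  mul1 f g n = (p * q)`_n.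
Proof.
move=> nN fp gq; rewrite coefM; apply: eq_bigr => i _.
rewrite fp ?gq //; first by rewrite (leq_ltn_trans (leq_subr _ _)).
by rewrite (leq_ltn_trans _ nN) // -ltnS.
Qed.

Lemma mul1C : commutative (@mul1 C).
Proof. by move=> f g; apply/funext => n; rewrite !(@mul1_poly n.+1) // mulrC. Qed.

Lemma mul1A : associative (@mul1 C).
Proof.
move=> f g h; apply/funext => n; set N := n.+1.
pose t (u : ser1 C) := \poly_(i < N) u i.
have tE u i : (i < N)%N -> u i = (t u)`_i by rewrite coef_poly => ->.
rewrite (@mul1_polyE N _ _ _ (t f) (t g * t h)) //; last 2 first.
- by move=> i; apply: tE.
- by move=> i iN; rewrite (mul1_poly _ _ iN).
rewrite (@mul1_polyE N _ _ _ (t f * t g) (t h)) ?mulrA //.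
  by move=> i iN; rewrite (mul1_poly _ _ iN).
by move=> i; apply: tE.
Qed.

Lemma mul1_coef (p q : {poly C}) :
  mul1 (fun k => p`_k) (fun k => q`_k) = (fun k => (p * q)`_k).
Proof. by apply/funext => n; rewrite coefM. Qed.

Lemma one1_coef : one1 C = (fun k => (1 : {poly C})`_k).
Proof. by apply/funext => n; rewrite coef1 /one1; case: eqP. Qed.

Lemma mul11 : left_id (one1 C) (@mul1 C).
Proof.
move=> f; apply/funext => n.
rewrite (@mul1_polyE n.+1 _ _ _ 1 (\poly_(i < n.+1) f i)) //.
- by rewrite mul1r coef_poly ltnSn.
- by move=> i _; rewrite one1_coef.
- by move=> i iN; rewrite coef_poly iN.
Qed.

HB.instance Definition _ :=
  Monoid.isComLaw.Build (ser1 C) (one1 C) (@mul1 C) mul1A mul1C mul11.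

Lemma mul1_scale (a b : C) f g :
  mul1 (scale1 a f) (scale1 b g) = scale1 (a * b) (mul1 f g).
Proof.
apply/funext => n; rewrite /mul1 /scale1 big_distrr /=.
by apply: eq_bigr => i _; rewrite mulrACA.
Qed.

Variables (R : realType) (nrm : C -> R).

(** Inverses in a commutative monoid are unique, so the choice made by [epsilon] is immaterial. *)
Lemma inv1_eq f g : in_tate1 nrm g -> mul1 f g = one1 C -> inv1 nrm f = g.
Proof.
move=> gT fg; rewrite /inv1.
set P := (fun _ => _); have [_] : P (ClassicalEpsilon.epsilon (inhabits (one1 C)) P).
  by apply: ClassicalEpsilon.epsilon_spec; exists g.
move: (ClassicalEpsilon.epsilon _ _) => h fh.
by rewrite -(mul11 h) -fg (mul1C f) -mul1A fh mul1C mul11.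
Qed.

Hypothesis nrmP : is_nonarch_abs nrm.
Hypothesis complete :
  forall x : nat -> C, cauchyC nrm x -> exists y, cvgC nrm x y.

Lemma nrm_mul1_le f g (M N : R) : 0 <= M -> 0 <= N ->
  (forall k, nrm (f k) <= M) -> (forall k, nrm (g k) <= N) ->
  forall k, nrm (mul1 f g k) <= M * N.
Proof.
move=> M0 N0 fM gN k; apply: (nrm_sum_le nrmP); first exact: mulr_ge0.
by move=> i _; rewrite (nrmM nrmP) ler_pM ?(nrm_ge0 nrmP).
Qed.

Lemma mul1_cvg (u v : nat -> ser1 C) f g k : bcvg nrm u f -> bcvg nrm v g ->
  cvgC nrm (fun n => mul1 (u n) (v n) k) (mul1 f g k).
Proof.
move=> uf vg; apply: bcvg_cvgC; rewrite /mul1.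
apply: bcvg_sum => // i _; apply: bcvgM => //.
  exact: (bcvg_comp (fun=> i : nat) uf).
exact: (bcvg_comp (fun=> (k - i)%N) vg).
Qed.

(** * Infinite products of the factors 1 - c_j t and of their inverses *)

Section InfiniteProduct.
Variables (c : nat -> C) (A : R).
Hypothesis c_lt1 : forall j, nrm (c j) < 1.
Hypothesis c_geo : forall j, nrm (c j) <= A / 2 ^+ j.

Definition linprod n : {poly C} := \prod_(i < n) (1 - (c i)%:P * 'X).

Lemma linprodS n : linprod n.+1 = linprod n * (1 - (c n)%:P * 'X).
Proof. by rewrite /linprod big_ord_recr. Qed.

(** For c_j = theta^(-q^j) this is convertible to [omega_fac], so that the results below apply
    directly to [omega]. *)
Definition linfac j : ser1 C :=
  fun k => if k == 0%N then 1 else if k == 1%N then - c j else 0.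

Lemma linfac_coef j : linfac j = fun k => (1 - (c j)%:P * 'X)`_k.
Proof.
apply/funext => k; rewrite coefB coef1 coefCM coefX /linfac.
by case: k => [|[|k]] /=; rewrite ?mulr0 ?subr0 ?mulr1 ?sub0r ?oppr0.
Qed.

Lemma linprod_coef n :
  \big[@mul1 C/one1 C]_(j < n) linfac j = fun k => (linprod n)`_k.
Proof.
rewrite /linprod; elim: n => [|n IH]; first by rewrite !big_ord0 one1_coef.
by rewrite !big_ord_recr /= IH linfac_coef mul1_coef.
Qed.

Lemma nrm_linfac_le1 j k : nrm (linfac j k) <= 1.
Proof.
rewrite /linfac; case: ifP => _; first by rewrite (nrm1 nrmP).
by case: ifP => _; rewrite ?(nrm0 nrmP) // (nrmN nrmP) ltW.
Qed.

Lemma nrm_linprod_le1 n k : nrm (linprod n)`_k <= 1.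
Proof.
have -> : (linprod n)`_k = (\big[@mul1 C/one1 C]_(j < n) linfac j) k.
  by rewrite linprod_coef.
elim: n k => [|n IH] k.
  by rewrite big_ord0 /one1; case: eqP => _; rewrite ?(nrm1 nrmP) ?(nrm0 nrmP).
rewrite big_ord_recr -[leRHS]mulr1; apply: nrm_mul1_le => //.
exact: nrm_linfac_le1.
Qed.

(** Consecutive products differ by c_n t times a polynomial with coefficients of norm at most 1. *)
Lemma linprod_cvg : exists B, bcvg nrm (fun n k => (linprod n)`_k) B.
Proof.
apply: (bcvg_tele nrmP complete (A := A) (M := 1)) => [k|n k].
  exact: nrm_linprod_le1.
rewrite linprodS mulrBr mulr1 coefB addrAC subrr add0r.
rewrite (nrmN nrmP) mulrCA coefCM (nrmM nrmP) -[leRHS]mulr1.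
rewrite ler_pM ?(nrm_ge0 nrmP) // coefMX; case: eqP => _.
  by rewrite (nrm0 nrmP).
exact: nrm_linprod_le1.
Qed.

Definition geom j : ser1 C := fun k => c j ^+ k.

Lemma geom_tate j : in_tate1 nrm (geom j).
Proof.
move=> e e0; have [N hN] : exists N, nrm (c j) ^+ N < e.
  have [->|cj0] := eqVneq (c j) 0.
    by exists 1%N; rewrite (nrm0 nrmP).
  pose x := nrm (c j); have x0 : 0 < x by rewrite (nrm_gt0 nrmP).
  have h0 : 0 < x^-1 - 1 by rewrite subr_gt0 invf_gt1 // c_lt1.
  (* Bernoulli's inequality: as 1/|c_j| exceeds 1, its powers grow at least linearly, so the powers
     of |c_j| tend to 0. *)
  have bern n : 1 + (x^-1 - 1) *+ n <= x^-1 ^+ n.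
    elim: n => [|n IH]; first by rewrite addr0.
    rewrite exprS; apply: (@le_trans _ _ (x^-1 * (1 + (x^-1 - 1) *+ n))).
      have -> : x^-1 = 1 + (x^-1 - 1) by ring.
      move: (x^-1 - 1) h0 => y y0; rewrite addrAC subrr add0r.
      rewrite mulrDr mulr1 mulrDl mul1r mulrS.
      have : 0 <= y * (y *+ n) by rewrite mulr_ge0 ?mulrn_wge0 // ltW.
      lra.
    by rewrite ler_pM2l // invr_gt0.
  exists (Num.bound ((e * (x^-1 - 1))^-1)).
  have := archi_boundP (ltW (_ : 0 < (e * (x^-1 - 1))^-1)).
  rewrite invr_gt0 mulr_gt0 // => /(_ isT); move: (Num.bound _) => n.
  rewrite invfM mulrC => hn.
  have : e^-1 < x^-1 ^+ n.
    apply: lt_le_trans (bern n); rewrite -mulr_natr.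
    move: hn; rewrite ltr_pdivrMl // => hn; apply: lt_le_trans hn _; lra.
  by rewrite exprVn ltf_pV2 ?posrE ?exprn_gt0.
exists N => n Nn; apply: le_lt_trans hN; rewrite (nrmX nrmP).
by rewrite ler_wiXn2l ?(nrm_ge0 nrmP) // ltW.
Qed.

Lemma nrm_geom_le1 j k : nrm (geom j k) <= 1.
Proof. by rewrite (nrmX nrmP) exprn_ile1 ?(nrm_ge0 nrmP) // ltW. Qed.

Lemma linfac_geom j : mul1 (linfac j) (geom j) = one1 C.
Proof.
apply/funext => -[|n]; rewrite /mul1.
  by rewrite big_ord_recl big_ord0 /= addr0 mul1r.
rewrite !big_ord_recl /= big1 => [|i _]; last by rewrite mul0r.
by rewrite /geom /bump /= subn0 subn1 mul1r mulNr -exprS addr0 subrr.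
Qed.

Lemma inv1_linfac j : inv1 nrm (linfac j) = geom j.
Proof. exact: inv1_eq (geom_tate j) (linfac_geom j). Qed.

Lemma geomprod_cvg :
  exists P, bcvg nrm (fun n => \big[@mul1 C/one1 C]_(j < n) geom j) P.
Proof.
have le1 n k : nrm ((\big[@mul1 C/one1 C]_(j < n) geom j) k) <= 1.
  elim: n k => [|n IH] k.
    by rewrite big_ord0 /one1; case: eqP => _; rewrite ?(nrm1 nrmP) ?(nrm0 nrmP).
  rewrite big_ord_recr -[leRHS]mulr1; apply: nrm_mul1_le => //.
  exact: nrm_geom_le1.
apply: (bcvg_tele nrmP complete (A := A) (M := 1)) => [k|n k] //.
rewrite big_ord_recr /=; move: (\big[_/_]_(j < n) _) (le1 n) => f f1.
(* The last term of the convolution is [f k] times the constant term 1 of [geom n]; every other term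
   contains a factor c_n. *)
have -> : mul1 f (geom n) k - f k = \sum_(i < k) f i * geom n (k - i)%N.
  by rewrite /mul1 big_ord_recr /= subnn mulr1 addrK.
have A0 : 0 <= A / 2 ^+ n by apply: le_trans (c_geo n); rewrite (nrm_ge0 nrmP).
apply: (nrm_sum_le nrmP) => // i _; rewrite (nrmM nrmP) -[leRHS]mul1r.
rewrite ler_pM ?(nrm_ge0 nrmP) // -(@prednK (k - i)) ?subn_gt0 //.
rewrite /geom exprS (nrmM nrmP) -[leRHS]mulr1 ler_pM ?(nrm_ge0 nrmP) //.
exact: nrm_geom_le1.
Qed.

(** The finite products of [geom] and of the linear factors are inverse to each other, and so are
    their limits, since multiplication is continuous coefficient by coefficient. The inverse of
    [omega] thus becomes a limit of polynomials. *)
Lemma inv1_infprod (a : C) (B : ser1 C) : a != 0 ->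
  bcvg nrm (fun n k => (linprod n)`_k) B ->
  inv1 nrm (scale1 a
    (limT1 nrm (fun n => \big[@mul1 C/one1 C]_(j < n) inv1 nrm (linfac j))))
  = scale1 a^-1 B.
Proof.
move=> a0 BP; have [P PP] := geomprod_cvg.
have -> : (fun n => \big[@mul1 C/one1 C]_(j < n) inv1 nrm (linfac j)) =
          (fun n => \big[@mul1 C/one1 C]_(j < n) geom j).
  by apply/funext => n; apply: eq_bigr => j _; rewrite inv1_linfac.
rewrite (limT1_eq nrmP PP); apply: inv1_eq.
  move=> e e0; have a'0 : 0 < nrm a by rewrite (nrm_gt0 nrmP).
  have [|N /(_ _ (leqnn _)) h] := BP.1 (nrm a * e); first by rewrite mulr_gt0.
  (* [B] is a uniform limit of polynomials: beyond the degree of [linprod N] its coefficients are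
     smaller than the allowed error. *)
  exists (size (linprod N)) => n Nn.
  have := h n; rewrite (nth_default 0 Nn) sub0r (nrmN nrmP) => hn.
  by rewrite (nrmM nrmP) (nrmV nrmP) ltr_pdivrMl.
have PB : mul1 P B = one1 C.
  apply/funext => k; apply: (cvgC_unique nrmP (mul1_cvg k PP BP)).
  move=> e e0; exists 0%N => n _.
  rewrite -linprod_coef -big_split big1 /=; first by rewrite subrr (nrm0 nrmP).
  by move=> j _; rewrite mul1C linfac_geom.
by rewrite mul1_scale divff // PB; apply/funext => n; rewrite /scale1 mul1r.
Qed.

End InfiniteProduct.
End Ser1.

(** * Carlitz polynomials *)

Section CarlitzAlgebra.
Variables (F : finFieldType) (C : fieldType) (inj : {rmorphism F -> C}).
Variable theta : C.
Local Notation q := #|F|.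

Lemma card_gt1 : (1 < q)%N.
Proof. exact: finNzRing_gt1. Qed.

Lemma card_pcharX : exists p n, [/\ prime p, p \in [pchar C] & q = (p ^ n.+1)%N].
Proof.
have [p pp pF] := finPcharP F.
have [n oF] : exists n, q = (p ^ n)%N by exists (logn p q); exact: card_pprimeChar pF.
case: n oF => [|n] oF; first by have := card_gt1; rewrite oF.
by exists p, n; split=> //; apply: (rmorph_pchar inj).
Qed.

Lemma card_pchar : [pchar C].-nat q.
Proof.
have [p [n [pp pC ->]]] := card_pcharX.
by rewrite pnatX pnatE // pC.
Qed.

Lemma frobD (x y : C) : (x + y) ^+ q = x ^+ q + y ^+ q.
Proof. exact: exprDn_pchar card_pchar. Qed.

Lemma inj_frob c : inj c ^+ q = inj c.
Proof. by rewrite -rmorphXn expf_card. Qed.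

Lemma frobN1 : (-1 : C) ^+ q = -1.
Proof. by rewrite -(rmorph1 inj) -rmorphN inj_frob. Qed.

Lemma frobN (x : C) : (- x) ^+ q = - x ^+ q.
Proof. by rewrite -mulN1r exprMn frobN1 mulN1r. Qed.

Lemma frobB (x y : C) : (x - y) ^+ q = x ^+ q - y ^+ q.
Proof. by rewrite frobD frobN. Qed.

Lemma exprq (x : C) : x ^+ q = x * x ^+ q.-1.
Proof. by rewrite -exprS prednK // (ltnW card_gt1). Qed.

Lemma exprqS (x : C) d : x ^+ (q ^ d.+1) = (x ^+ (q ^ d)) ^+ q.
Proof. by rewrite expnSr exprM. Qed.

Lemma card_eq0 : (q%:R : C) = 0.
Proof.
have [p [n [pp pC ->]]] := card_pcharX.
by apply/eqP; rewrite -(dvdn_pcharf pC) dvdn_exp.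
Qed.

(** Carlitz's [j+1]; the shift leaves out [0] = 0. *)
Definition bracket j : C := theta ^+ (q ^ j.+1) - theta.

Lemma bracketE j : bracket j = theta ^+ (q ^ j.+1) - theta.
Proof. by []. Qed.

(** Carlitz's recursion D_j = [j] D_(j-1)^q; agreement with the product over monic polynomials is
    [DjE]. *)
Fixpoint Dc j : C := if j is i.+1 then bracket i * Dc i ^+ q else 1.

(* The product of the X - a over deg a < d (see [ed_prod]), by Carlitz's recursion;
   [lc d] is its derivative, a constant. *)
Fixpoint ed d : {poly C} :=
  if d is i.+1 then ed i ^+ q - (Dc i ^+ q.-1) *: ed i else 'X.

Fixpoint lc d : C := if d is i.+1 then - (Dc i ^+ q.-1 * lc i) else 1.

Lemma ev0 x : (ed 0).[x] = x. Proof. by rewrite hornerX. Qed.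

Lemma evS d x :
  (ed d.+1).[x] = (ed d).[x] ^+ q - Dc d ^+ q.-1 * (ed d).[x].
Proof. by rewrite /= !hornerE ?horner_exp. Qed.

Lemma evD d x y : (ed d).[x + y] = (ed d).[x] + (ed d).[y].
Proof.
by elim: d => [|d IH]; rewrite ?ev0 // !evS IH frobD mulrDr opprD addrACA.
Qed.

Lemma evZ d c x : (ed d).[inj c * x] = inj c * (ed d).[x].
Proof.
elim: d => [|d IH]; rewrite ?ev0 // !evS IH exprMn inj_frob mulrBr.
by rewrite mulrCA.
Qed.

Lemma ev_at0 d : (ed d).[0] = 0.
Proof. by rewrite -[X in _.[X]](mul0r 0) -(rmorph0 inj) evZ rmorph0 mul0r. Qed.

Lemma ev_sum d (I : finType) (G : I -> C) :
  (ed d).[\sum_i G i] = \sum_i (ed d).[G i].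
Proof. exact: (big_morph _ (evD d) (ev_at0 d)). Qed.

Lemma bracketS j : bracket j ^+ q = bracket j.+1 - bracket 0.
Proof. by rewrite /bracket frobB -exprqS expn1; ring. Qed.

(** Induction: the recursion for e_(d+2) at theta x involves the q-th power of the formula one step
    below, where [d+1]^q = [d+2] - [1]. *)
Lemma ev_mulX d x :
  (ed d.+1).[theta * x] = theta * (ed d.+1).[x] + bracket d * (ed d).[x] ^+ q.
Proof.
elim: d => [|d IH].
  by rewrite !evS !ev0 /bracket expn1 expr1n exprMn; ring.
rewrite evS {}IH [in RHS]evS frobD !exprMn bracketS.
have eS : (ed d.+1).[x] ^+ q =
    ((ed d).[x] ^+ q) ^+ q - (Dc d ^+ q) ^+ q.-1 * (ed d).[x] ^+ q.
  by rewrite evS frobB exprMn exprAC.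
have -> : ((ed d).[x] ^+ q) ^+ q =
    (ed d.+1).[x] ^+ q + (Dc d ^+ q) ^+ q.-1 * (ed d).[x] ^+ q.
  by rewrite eS subrK.
have bq : bracket d * bracket d ^+ q.-1 = bracket d.+1 - bracket 0.
  by rewrite -exprq bracketS.
have b0 : bracket 0 = theta ^+ q - theta by rewrite /bracket expn1.
move: (bracket d) (bracket d.+1) (bracket 0) (bracket d ^+ _) bq b0 => B B' B0 Bq bq b0.
move: (Dc d ^+ q ^+ _) ((ed d).[x] ^+ q) ((ed d.+1).[x]) => E y Y.
have -> : theta ^+ q = B0 + theta by rewrite b0 subrK.
have -> : B' = B * Bq + B0 by rewrite bq subrK.
ring.
Qed.

(** Both claims go together: e_(d+1) = e_d^q - D_d^(q-1) e_d vanishes at theta^d because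
    e_d(theta^d) = D_d, and then [ev_mulX] gives the value D_(d+1) at theta^(d+1). *)
Lemma ev_theta d : (ed d).[theta ^+ d] = Dc d /\
  forall m, (m < d)%N -> (ed d).[theta ^+ m] = 0.
Proof.
elim: d => [|d [IH1 IH2]]; first by rewrite ev0 expr0.
have ed0 : (ed d.+1).[theta ^+ d] = 0.
  by rewrite evS IH1 mulrC -exprq subrr.
split=> [|m]; first by rewrite exprS ev_mulX ed0 mulr0 add0r IH1.
rewrite ltnS leq_eqVlt => /orP[/eqP->//|md].
by rewrite evS IH2 // mulr0 subr0 expr0n (gtn_eqF (ltnW card_gt1)).
Qed.

Lemma evalA_polyA d (c : {ffun 'I_d -> F}) :
  evalA inj theta (polyA c) = \sum_(i < d) inj (c i) * theta ^+ i.
Proof.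
rewrite /evalA /polyA rmorph_sum horner_sum; apply: eq_bigr => i _.
by rewrite rmorphM rmorphXn /= map_polyC map_polyX !hornerE.
Qed.

Lemma ev_evalA d (c : {ffun 'I_d -> F}) :
  (ed d).[evalA inj theta (polyA c)] = 0.
Proof.
rewrite evalA_polyA ev_sum big1 // => i _.
by rewrite evZ (ev_theta d).2 ?mulr0.
Qed.

(** The q-th power in the recursion has derivative 0, because q = 0 in [C]. *)
Lemma deriv_ed d : (ed d)^`() = (lc d)%:P.
Proof.
elim: d => [|d IH] /=; first by rewrite derivX.
rewrite derivB derivZ IH deriv_exp -mulr_natl -polyC_natr card_eq0 polyC0 mul0r.
by rewrite sub0r -mul_polyC -polyCM -polyCN.
Qed.

Lemma size_ed d : size (ed d) = (q ^ d).+1 /\ ed d \is monic.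
Proof.
elim: d => [|d [sd md]]; first by rewrite size_polyX monicX.
have sq : size (ed d ^+ q) = (q ^ d.+1).+1.
  have e0 : ed d != 0 by apply: monic_neq0.
  apply: succn_inj; rewrite -[RHS]addn1 -addn1 ; have := size_exp (ed d) q.
  rewrite sd /= -expnSr => <-; rewrite prednK ?addn1 //.
  by rewrite lt0n size_poly_eq0 expf_neq0.
have lt : (size (- (Dc d ^+ q.-1 *: ed d)) < size (ed d ^+ q))%N.
  rewrite size_polyN sq; apply: (leq_ltn_trans (size_scale_leq _ _)).
  by rewrite sd ltnS ltn_exp2l ?card_gt1.
split; first by rewrite /= size_polyDl.
by rewrite monicE /= lead_coefDl // -monicE monic_exp.
Qed.

Hypothesis bracket_neq0 : forall j, bracket j != 0.

Lemma Dc_neq0 d : Dc d != 0.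
Proof. by elim: d => [|d IH] /=; rewrite ?oner_neq0 // mulf_neq0 ?expf_neq0. Qed.

Definition Ed d x : C := (ed d).[x] / Dc d.

Lemma EdD d x y : Ed d (x + y) = Ed d x + Ed d y.
Proof. by rewrite /Ed evD mulrDl. Qed.

Lemma EdZ d c x : Ed d (inj c * x) = inj c * Ed d x.
Proof. by rewrite /Ed evZ mulrA. Qed.

Lemma Ed_frob d x : Ed d x ^+ q = Ed d x + (ed d.+1).[x] / Dc d ^+ q.
Proof.
have D0 := Dc_neq0 d; have Dq : Dc d ^+ q.-1 != 0 by apply: expf_neq0.
rewrite evS /Ed expr_div_n (exprq (Dc d)); field.
by rewrite D0 Dq.
Qed.

(** [ev_mulX] gives theta E_(d+1) + E_d^q, and [Ed_frob] replaces E_d^q by E_d + [d+1] E_(d+1). *)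
Lemma Ed_mulX d x : Ed d.+1 (theta * x) = theta ^+ (q ^ d.+1) * Ed d.+1 x + Ed d x.
Proof.
have D0 := Dc_neq0 d; have Dq : Dc d ^+ q != 0 by apply: expf_neq0.
have b0 := bracket_neq0 d.
have -> : Ed d.+1 (theta * x) = theta * Ed d.+1 x + Ed d x ^+ q.
  rewrite {1 2}/Ed ev_mulX expr_div_n [Dc d.+1]/=.
  by field; rewrite Dq b0.
have -> : Ed d x ^+ q = Ed d x + bracket d * Ed d.+1 x.
  rewrite Ed_frob {3}/Ed [Dc d.+1]/=.
  by field; rewrite Dq b0.
have -> : theta ^+ (q ^ d.+1) = bracket d + theta by rewrite subrK.
ring.
Qed.

Definition bt d : {poly C} := \prod_(i < d) ('X - (theta ^+ (q ^ i))%:P).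

Lemma btS d : bt d.+1 = bt d * ('X - (theta ^+ (q ^ d))%:P).
Proof. by rewrite /bt big_ord_recr. Qed.

Definition Psi d x : {poly C} := \sum_(j < d) Ed j x *: bt j.

Lemma PsiS d x : Psi d.+1 x = Psi d x + Ed d x *: bt d.
Proof. by rewrite /Psi big_ord_recr. Qed.

(** The rule t b_j = b_(j+1) + theta^(q^j) b_j matches [Ed_mulX], so the sum telescopes up to its
    last term. *)
Lemma Psi_mulX d x :
  Psi d.+1 (theta * x) = Psi d.+1 x * 'X - Ed d x *: bt d.+1.
Proof.
elim: d => [|d IH].
  rewrite !PsiS {1 2}/Psi !big_ord0 !add0r btS /bt big_ord0 /Ed !ev0 !divr1 expr1.
  by rewrite -!mul_polyC !polyCM; ring.
rewrite PsiS {}IH [in RHS]PsiS Ed_mulX (btS d.+1).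
by rewrite -!mul_polyC !polyCD !polyCM; ring.
Qed.

Lemma PsiD d x y : Psi d (x + y) = Psi d x + Psi d y.
Proof. by rewrite -big_split; apply: eq_bigr => j _; rewrite EdD scalerDl. Qed.

Lemma PsiZ d c x : Psi d (inj c * x) = inj c *: Psi d x.
Proof. by rewrite scaler_sumr; apply: eq_bigr => j _; rewrite EdZ scalerA. Qed.

Lemma Psi0 d : Psi d 0 = 0.
Proof. by rewrite -[0 in LHS](mul0r 0) -(rmorph0 inj) PsiZ rmorph0 scale0r. Qed.

(** In [Psi_mulX] the extra term vanishes at theta^m for small m, so multiplication by theta becomes
    multiplication by t. *)
Lemma Psi_theta d m : (m < d)%N -> Psi d (theta ^+ m) = 'X^m.
Proof.
case: d => // d; elim: m => [_|m IH md].
  rewrite /Psi big_ord_recl big1 => [|i _].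
    by rewrite addr0 /bt big_ord0 /Ed ev0 divr1 scale1r.
  by rewrite /Ed (ev_theta _).2 // mul0r scale0r.
rewrite exprS Psi_mulX IH 1?ltnW // /Ed (ev_theta _).2 //.
by rewrite mul0r scale0r subr0 exprSr.
Qed.

Lemma Psi_evalA d (c : {ffun 'I_d -> F}) k :
  (Psi d (evalA inj theta (polyA c)))`_k = inj (polyA c)`_k.
Proof.
have -> : Psi d (evalA inj theta (polyA c)) = map_poly inj (polyA c).
  rewrite evalA_polyA (big_morph _ (PsiD d) (Psi0 d)) /polyA rmorph_sum.
  apply: eq_bigr => i _.
  by rewrite PsiZ Psi_theta // rmorphM rmorphXn /= map_polyC map_polyX mul_polyC.
by rewrite coef_map.
Qed.

Lemma polyA_coef d (c : {ffun 'I_d -> F}) (i : 'I_d) : (polyA c)`_i = c i.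
Proof.
rewrite /polyA coef_sum (bigD1 i) //= big1 => [|j ji].
  by rewrite coefCM coefXn eqxx mulr1 addr0.
rewrite coefCM coefXn; case: eqP => [/val_inj ij|_]; last by rewrite mulr0.
by rewrite ij eqxx in ji.
Qed.

(** The coefficients of a are recovered from the value a(theta) by interpolation. *)
Lemma evalA_inj d :
  injective (fun c : {ffun 'I_d -> F} => evalA inj theta (polyA c)).
Proof.
move=> c c' /= cc'; apply/ffunP => i; apply: (fmorph_inj inj).
by rewrite -!polyA_coef -!Psi_evalA cc'.
Qed.

(** e_d is monic of degree q^d and vanishes at q^d distinct points. *)
Lemma ed_prod d :
  ed d = \prod_(c : {ffun 'I_d -> F}) ('X - (evalA inj theta (polyA c))%:P).
Proof.
pose rs := [seq evalA inj theta (polyA c) | c : {ffun 'I_d -> F}].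
have [sd /monicP md] := size_ed d.
rewrite [LHS](@all_roots_prod_XsubC _ _ rs).
- by rewrite md scale1r big_map big_enum.
- by rewrite sd size_map -cardE card_ffun card_ord.
- by apply/allP => _ /mapP[c _ ->]; rewrite /root ev_evalA.
- by rewrite uniq_rootsE map_inj_uniq ?enum_uniq //; apply: evalA_inj.
Qed.

Lemma polyA_opp d (c : {ffun 'I_d -> F}) :
  evalA inj theta (polyA [ffun i => - c i]) = - evalA inj theta (polyA c).
Proof.
rewrite !evalA_polyA -sumrN; apply: eq_bigr => i _.
by rewrite ffunE rmorphN mulNr.
Qed.

(** D_d = e_d(theta^d), read on the factorisation of e_d; changing the sign of [c] turns theta^d - a
    into theta^d + a. *)
Lemma DjE d : Dj inj theta d = Dc d.
Proof.
rewrite -(ev_theta d).1 ed_prod horner_prod /Dj.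
have oppK : involutive (fun c : {ffun 'I_d -> F} => [ffun i => - c i]).
  by move=> c; apply/ffunP => i; rewrite !ffunE opprK.
rewrite (reindex_inj (inv_inj oppK)); apply: eq_bigr => c _.
rewrite hornerXsubC -polyA_opp /evalA rmorphD rmorphXn /= map_polyX.
by rewrite hornerD hornerXn.
Qed.

End CarlitzAlgebra.

(** As the derivative is the constant l, the product [G i] of the other factors takes the value l at
    a_i. Hence the sum of the P(a_i) G_i minus l P has #|I| roots and smaller degree, so it is 0. *)
Lemma lagrange_sum (C : fieldType) (I : finType) (a : I -> C) (l z : C)
    (P : {poly C}) :
  injective a -> (\prod_i ('X - (a i)%:P))^`() = l%:P -> (size P <= #|I|)%N ->
  (forall i, z != a i) ->
  (\sum_i P.[a i] / (z - a i)) * \prod_i (z - a i) = l * P.[z].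
Proof.
move=> ainj dl sP za.
pose G i : {poly C} := \prod_(j | j != i) ('X - (a j)%:P).
have pG i : \prod_j ('X - (a j)%:P) = ('X - (a i)%:P) * G i.
  by rewrite (bigD1 i).
have Gl i : (G i).[a i] = l.
  have := congr1 (fun p => p.[a i]) dl; rewrite (pG i) derivM derivXsubC mul1r.
  by rewrite hornerD hornerM hornerXsubC subrr mul0r addr0 hornerC.
have G0 i j : j != i -> (G i).[a j] = 0.
  by move=> ji; rewrite horner_prod (bigD1 j) //= hornerXsubC subrr mul0r.
have sG i : (size (G i) <= #|I|)%N.
  have : size (\prod_j ('X - (a j)%:P)) = #|I|.+1.
    by rewrite size_prod_XsubC /index_enum -enumT -cardE.
  rewrite (pG i) size_monicM ?monicXsubC ?size_XsubC //=.
    by case; rewrite add0n => ->.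
  by apply/monic_neq0/monic_prod => j _; apply: monicXsubC.
have H0 : \sum_i P.[a i] *: G i - l *: P = 0.
  apply: (@roots_geq_poly_eq0 _ _ [seq a i | i : I]).
  - apply/allP => _ /mapP[j _ ->]; rewrite /root !hornerE horner_sum (bigD1 j) //=.
    rewrite big1 => [|i ij]; last by rewrite hornerZ G0 ?mulr0 // eq_sym.
    by rewrite hornerZ Gl addr0 mulrC subrr.
  - by rewrite map_inj_uniq ?enum_uniq.
  - rewrite size_map -cardE (leq_trans (size_polyD _ _)) // geq_max size_polyN.
    rewrite (leq_trans (size_scale_leq _ _) sP) andbT.
    apply: (leq_trans (size_sum _ _ _)); apply/bigmax_leqP => i _.
    exact: leq_trans (size_scale_leq _ _) (sG i).
have := congr1 (fun p => p.[z]) H0; rewrite horner0 hornerD hornerN hornerZ.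
move/eqP; rewrite subr_eq0 => /eqP <-; rewrite horner_sum mulr_suml.
apply: eq_bigr => i _; rewrite hornerZ horner_prod -mulrA (bigD1 i) //=.
rewrite mulKf ?subr_eq0 //; congr (_ * _).
by apply: eq_bigr => j _; rewrite hornerXsubC.
Qed.

(** * The identity at finite level *)

Section FiniteIdentity.
Variables (F : finFieldType) (C : fieldType) (inj : {rmorphism F -> C}).
Variable theta : C.
Local Notation q := #|F|.
Hypothesis bracket_neq0 : forall j, bracket F theta j != 0.
Local Notation ed := (ed F theta).
Local Notation Dc := (Dc F theta).
Local Notation Ed := (Ed F theta).
Local Notation lc := (lc F theta).
Local Notation bt := (bt F theta).
Local Notation Psi := (Psi F theta).

Definition Ep d : {poly C} := (Dc d)^-1 *: ed d.

Lemma horner_Ep d x : (Ep d).[x] = Ed d x.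
Proof. by rewrite hornerZ mulrC. Qed.

Lemma Ep_frob d : Ep d ^+ q = Ep d + (Dc d ^- q)%:P * ed d.+1.
Proof.
have D0 : Dc d != 0 by apply: Dc_neq0.
rewrite /Ep exprZn exprVn mul_polyC /= scalerBr scalerA.
rewrite [X in (X ^-1 * _) *: _](exprq F) invfM -mulrA mulVf ?expf_neq0 // mulr1.
by rewrite addrC subrK.
Qed.

(** [Psi] is a polynomial in t for given z; Lagrange interpolation needs the coefficient of each t^k
    as a polynomial in z. *)
Definition psi d k : {poly C} := \sum_(j < d) (bt j)`_k *: Ep j.

Lemma horner_psi d k x : (psi d k).[x] = (Psi d x)`_k.
Proof.
rewrite /psi /Psi horner_sum coef_sum; apply: eq_bigr => j _.
by rewrite hornerZ horner_Ep coefZ mulrC.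
Qed.

Lemma psiS d k : psi d.+1 k = psi d k + (bt d)`_k *: Ep d.
Proof. by rewrite /psi big_ord_recr. Qed.

Lemma size_Ep d : (size (Ep d) <= (q ^ d).+1)%N.
Proof. by rewrite (leq_trans (size_scale_leq _ _)) // (size_ed F theta d).1. Qed.

(** [q ^ d %/ q] stands for q^(d-1), and is 0 for d = 0, where [psi] vanishes. *)
Lemma size_psi d k : (size (psi d k) <= (q ^ d %/ q).+1)%N.
Proof.
have q1 := card_gt1 F.
case: d => [|d]; first by rewrite /psi big_ord0 size_poly0.
rewrite expnS mulKn ?(ltnW q1) //.
apply: (leq_trans (size_sum _ _ _)); apply/bigmax_leqP => j _.
rewrite (leq_trans (size_scale_leq _ _)) // (leq_trans (size_Ep _)) //.
by rewrite ltnS leq_pexp2l ?(ltnW q1) // -ltnS.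
Qed.

Lemma size_mul_le (p r : {poly C}) m n :
  (size p <= m.+1)%N -> (size r <= n.+1)%N -> (size (p * r)%R <= (m + n).+1)%N.
Proof.
move=> pm rn; apply: leq_trans (size_polyMleq _ _) _.
by move: (size p) (size r) pm rn; clear => a c; lia.
Qed.

Lemma size_expr_le (p : {poly C}) m n :
  (size p <= m.+1)%N -> (size (p ^+ n)%R <= (n * m).+1)%N.
Proof.
move=> pm; elim: n => [|n IH]; first by rewrite size_poly1.
by rewrite exprS mulSn size_mul_le.
Qed.

Section Subsets.
Variables (s d : nat) (b : 'I_s -> nat).
Implicit Type al : {ffun 'I_s -> bool}.

Definition ones al : nat := \sum_(i : 'I_s) (al i : nat).

Lemma ones_le al : (ones al <= s)%N.
Proof.
rewrite -[leqRHS]card_ord -sum1_card; apply: leq_sum => i _.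
by case: (al i).
Qed.

Lemma zeros_eq al : \sum_(i : 'I_s) (~~ al i : nat) = (s - ones al)%N.
Proof.
suff e : (\sum_(i : 'I_s) (~~ al i : nat) + ones al)%N = s by rewrite -[in RHS]e addnK.
rewrite -big_split /= -[RHS]card_ord -sum1_card.
by apply: eq_bigr => i _; case: (al i).
Qed.

Lemma prod_pick (A : comNzRingType) (x : A) al :
  \prod_i (if al i then 1 else x) = x ^+ (s - ones al).
Proof.
rewrite -zeros_eq; elim/big_rec2: _ => [|i n y _ ->] //.
by case: (al i); rewrite ?mul1r // exprS.
Qed.

(** [al] chooses Psi_d or E_d b_d in each factor Psi_(d+1) = Psi_d + E_d b_d; the powers of E_d are
    kept apart for the reduction. *)
Definition Gp al : {poly C} :=
  \prod_i (if al i then psi d (b i) else ((bt d)`_(b i))%:P).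

Lemma size_Gp al : (size (Gp al) <= (ones al * (q ^ d %/ q)).+1)%N.
Proof.
rewrite /Gp /ones big_distrl /=.
elim/big_rec2: _ => [|i n y _ yn]; first by rewrite size_poly1.
apply: size_mul_le => //; case: (al i); first by rewrite mul1n size_psi.
by rewrite mul0n size_polyC; case: eqP.
Qed.

Lemma prod_psi : \prod_i psi d.+1 (b i) = \sum_al Gp al * Ep d ^+ (s - ones al).
Proof.
pose f i (a : bool) := if a then psi d (b i) else (bt d)`_(b i) *: Ep d.
transitivity (\prod_i \sum_a f i a).
  by apply: eq_bigr => i _; rewrite psiS big_bool.
rewrite bigA_distr_bigA; apply: eq_bigr => al _.
rewrite -prod_pick -big_split; apply: eq_bigr => i _.
by rewrite /f; case: (al i) => /=; rewrite ?mulr1 ?mul_polyC.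
Qed.

(** Quotient and, in [Rp], remainder by e_(d+1): if at least q factors E_d occur, E_d^(m+q) is
    replaced by E_d^(m+1) + E_d^m e_(d+1)/D_d^q; otherwise nothing is reduced. *)
Definition Qp al : {poly C} :=
  if (ones al + q <= s)%N
  then Gp al * Ep d ^+ (s - (ones al + q)) * (Dc d ^- q)%:P else 0.

Definition Rp al : {poly C} :=
  Gp al * Ep d ^+ (if (ones al + q <= s)%N then (s - (ones al + q)).+1
                   else s - ones al)%N.

Lemma Gp_div al : Gp al * Ep d ^+ (s - ones al) = Rp al + Qp al * ed d.+1.
Proof.
rewrite /Rp /Qp; case: leqP => h; last by rewrite mul0r addr0.
have -> : (s - ones al)%N = (s - (ones al + q) + q)%N by lia.
by rewrite exprD Ep_frob exprSr; ring.
Qed.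

(* The degree is at most q^(d-1) (q^2 - 1): this is where s <= 2(q-1) enters. *)
Lemma size_Rp al : (s <= 2 * q.-1)%N -> (size (Rp al) <= q ^ d.+1)%N.
Proof.
move=> sq; rewrite /Rp; set m := (if _ then _ else _).
have q1 := card_gt1 F.
have [mq nm] : (m <= q.-1)%N /\ (ones al + m <= 2 * q.-1)%N.
  rewrite /m; have := ones_le al.
  by case: (leqP (ones al + q)%N s); move: #|F| (ones al) sq q1; lia.
have := size_mul_le (size_Gp al) (size_expr_le m (size_Ep d)).
move=> h; apply: (leq_trans h).
have : ((q ^ d %/ q) * q <= q ^ d)%N by apply: leq_divM.
move: (_ %/ _)%N => r rq; have q0 : (0 < q ^ d)%N by rewrite expn_gt0 (ltnW q1).
rewrite expnS; move: (q ^ d)%N rq q0 => Y rq Y0.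
move: (ones al) nm {h} => n nm.
(* After multiplication by q it suffices that n + m q is at most 2(q-1) + (q-1)^2 = q^2 - 1. *)
rewrite -(ltn_pmul2r (ltnW q1)).
apply: (@leq_ltn_trans ((n + m * q) * Y)); first by rewrite !mulnDl; nia.
rewrite [X in (_ < X)%N]mulnAC ltn_pmul2r //.
by move: q1 mq nm {sq rq}; case: #|F| => // k _ /= mk nk; nia.
Qed.

Lemma finite_identity z :
  (s <= 2 * q.-1)%N -> (ed d.+1).[z] != 0 ->
  \sum_(c : {ffun 'I_d.+1 -> F})
     inj (\prod_(i : 'I_s) (polyA c)`_(b i)) / (z - evalA inj theta (polyA c)) =
  lc d.+1 / (ed d.+1).[z] * \prod_i (Psi d.+1 z)`_(b i)
  - lc d.+1 / Dc d ^+ q *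
    \sum_(al | (ones al + q <= s)%N)
      (\prod_i (if al i then (Psi d z)`_(b i) else (bt d)`_(b i)))
      * Ed d z ^+ (s - (ones al + q)).
Proof.
move=> sq ez.
pose a (c : {ffun 'I_d.+1 -> F}) := evalA inj theta (polyA c).
pose P := \prod_i psi d.+1 (b i); pose Rm := \sum_al Rp al.
pose Q := \sum_al Qp al.
have PRQ : P = Rm + Q * ed d.+1.
  rewrite /P prod_psi mulr_suml -big_split; apply: eq_bigr => al _.
  exact: Gp_div.
have edE : ed d.+1 = \prod_c ('X - (a c)%:P) by apply: ed_prod.
(* At the roots of e_(d+1) the multiple of e_(d+1) drops out, so the low-degree [Rm] interpolates
   the same values as [P]. *)
have Ra c : Rm.[a c] = inj (\prod_(i : 'I_s) (polyA c)`_(b i)).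
  have -> : Rm.[a c] = P.[a c].
    by rewrite PRQ hornerD hornerM [(ed _).[_]](ev_evalA inj) mulr0 addr0.
  rewrite /P horner_prod rmorph_prod; apply: eq_bigr => i _.
  by rewrite horner_psi (Psi_evalA inj).
have ezE : (ed d.+1).[z] = \prod_c (z - a c).
  by rewrite edE horner_prod; apply: eq_bigr => c _; rewrite hornerXsubC.
have := @lagrange_sum C _ a (lc d.+1) z Rm.
have ainj : injective a by apply: evalA_inj.
rewrite -ezE -edE => /(_ ainj (deriv_ed inj theta _)).
have -> : (size Rm <= #|{ffun 'I_d.+1 -> F}|)%N.
  rewrite card_ffun card_ord; apply: (leq_trans (size_sum _ _ _)).
  by apply/bigmax_leqP => al _; apply: size_Rp.
move=> /(_ isT) lag.
have za c : z != a c.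
  by apply: contraNneq ez => ->; rewrite [X in X == _](ev_evalA inj).
move/(_ za) in lag.
have -> : \sum_c inj (\prod_(i : 'I_s) (polyA c)`_(b i)) / (z - a c) =
   lc d.+1 * Rm.[z] / (ed d.+1).[z].
  rewrite -lag mulfK //; apply: eq_bigr => c _; by rewrite Ra.
have Pz : P.[z] = \prod_i (Psi d.+1 z)`_(b i).
  by rewrite /P horner_prod; apply: eq_bigr => i _; rewrite horner_psi.
have Qz : Q.[z] = (Dc d ^+ q)^-1 * \sum_(al | (ones al + q <= s)%N)
      (\prod_i (if al i then (Psi d z)`_(b i) else (bt d)`_(b i)))
      * Ed d z ^+ (s - (ones al + q)).
  rewrite /Q horner_sum mulr_sumr [RHS]big_mkcond; apply: eq_bigr => al _.
  rewrite /Qp; case: ifP => _; last by rewrite horner0.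
  rewrite !hornerM hornerC horner_exp horner_Ep mulrC; congr (_ * (_ * _)).
  rewrite horner_prod; apply: eq_bigr => i _.
  by case: (al i); rewrite ?horner_psi ?hornerC.
have -> : Rm.[z] = P.[z] - Q.[z] * (ed d.+1).[z].
  by rewrite PRQ hornerD hornerM addrK.
rewrite Pz Qz mulrBr mulrBl; congr (_ - _); first by rewrite mulrAC.
by rewrite mulrA mulfK // mulrA.
Qed.

End Subsets.
End FiniteIdentity.

(** * Expansion of [e_d] *)

Section CarlitzExpansion.
Variables (F : finFieldType) (C : fieldType) (inj : {rmorphism F -> C}).
Variable theta : C.
Local Notation q := #|F|.
Hypothesis bracket_neq0 : forall j, bracket F theta j != 0.
Local Notation bracket := (bracket F theta).
Local Notation ed := (ed F theta).
Local Notation Dc := (Dc F theta).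
Local Notation Ed := (Ed F theta).
Local Notation lc := (lc F theta).

Lemma frobBX k (x y : C) : (x - y) ^+ (q ^ k) = x ^+ (q ^ k) - y ^+ (q ^ k).
Proof.
elim: k => [|k IH]; first by rewrite !expr1.
by rewrite !exprqS IH (frobB inj).
Qed.

Lemma frob_sign k (d : nat) : ((-1 : C) ^+ d) ^+ (q ^ k) = (-1) ^+ d.
Proof.
elim: k => [|k IH]; first by rewrite expr1.
by rewrite exprqS IH exprAC (frobN1 inj).
Qed.

Lemma frob_sign1 (d : nat) : ((-1 : C) ^+ d) ^+ q = (-1) ^+ d.
Proof. by have := frob_sign 1 d; rewrite expn1. Qed.

(** Valid for every parity of q, as (-1)^q = -1 in [C]. *)
Lemma sign_pred (d : nat) : ((-1 : C) ^+ d) ^+ q.-1 = 1.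
Proof.
have s0 : (-1 : C) ^+ d != 0 by rewrite signr_eq0.
by apply: (mulfI s0); rewrite -exprq frob_sign1 mulr1.
Qed.

(** Carlitz's L_d = [1]...[d], which is D_d/l_d up to sign ([Dc_lc]). *)
Definition Lc d : C := \prod_(i < d) bracket i.

Lemma LcS d : Lc d.+1 = Lc d * bracket d.
Proof. by rewrite /Lc big_ord_recr. Qed.

Lemma Lc_neq0 d : Lc d != 0.
Proof. by apply/prodf_neq0 => i _. Qed.

Lemma lc_neq0 d : lc d != 0.
Proof.
elim: d => [|d IH] /=; rewrite ?oner_neq0 // oppr_eq0 mulf_neq0 //.
exact/expf_neq0/Dc_neq0.
Qed.

Lemma Dc_lc d : Dc d = (-1) ^+ d * lc d * Lc d.
Proof.
elim: d => [|d IH]; first by rewrite /Lc big_ord0 expr0 !mulr1.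
by rewrite LcS /= exprq {1}IH exprS; ring.
Qed.

(** Normalised to have linear coefficient 1: this is x times the product of the 1 - x/a over nonzero
    a with deg a < d. *)
Definition eps d x : C := (ed d).[x] / lc d.

Lemma eps0 x : eps 0 x = x.
Proof. by rewrite /eps ev0 divr1. Qed.

Lemma Ed_eps d x : Ed d x = (-1) ^+ d * eps d x / Lc d.
Proof.
have s0 : (-1 : C) ^+ d != 0 by rewrite signr_eq0.
rewrite /Ed /eps Dc_lc !invfM invr_sign; ring.
Qed.

Lemma epsS d x : eps d.+1 x = eps d x - eps d x * Ed d x ^+ q.-1.
Proof.
have D0 : Dc d != 0 by apply: Dc_neq0.
have Dq : Dc d ^+ q.-1 != 0 by apply: expf_neq0.
have l0 := lc_neq0 d.
rewrite /eps /Ed evS exprq expr_div_n /=; field.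
by rewrite oppr_eq0 mulf_neq0 ?Dq ?l0.
Qed.

(** The term of degree q^i in Carlitz's closed formula for e_d(x)/l_d. *)
Definition eps_term d i x : C :=
  (-1) ^+ i * Lc d / (Dc i * Lc (d - i) ^+ (q ^ i)) * x ^+ (q ^ i).

Lemma eps_term0 d x : eps_term d 0 x = x.
Proof.
rewrite /eps_term expr0 subn0 expn0 !expr1 !mul1r divff ?mul1r //.
exact: Lc_neq0.
Qed.

Lemma eps_term_frob d i x : eps_term d i x ^+ q / Lc d ^+ q.-1 =
  (-1) ^+ i * Lc d / (Dc i ^+ q * Lc (d - i) ^+ (q ^ i.+1)) * x ^+ (q ^ i.+1).
Proof.
have L0 : Lc d ^+ q.-1 != 0 by apply/expf_neq0/Lc_neq0.
have L1 : Lc (d - i) ^+ (q ^ i.+1) != 0 by apply/expf_neq0/Lc_neq0.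
have D0 : Dc i ^+ q != 0 by apply/expf_neq0/Dc_neq0.
rewrite /eps_term !exprMn exprVn exprMn frob_sign1 -!exprqS (exprq F (Lc d)).
by field; rewrite L0 L1 D0.
Qed.

(** A Pascal-type rule, which comes down to [d+1] = [d-i]^(q^(i+1)) + [i+1]. *)
Lemma eps_termS d i x : (i < d)%N -> eps_term d.+1 i.+1 x =
  eps_term d i.+1 x - eps_term d i x ^+ q / Lc d ^+ q.-1.
Proof.
move=> id; rewrite eps_term_frob /eps_term subSS -subnSK // LcS.
set m := (d - i.+1)%N; rewrite LcS [(_ * bracket m) ^+ _]exprMn /= exprS.
have L1 : Lc m ^+ (q ^ i.+1) != 0 by apply/expf_neq0/Lc_neq0.
have B1 : bracket m ^+ (q ^ i.+1) != 0 by apply: expf_neq0.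
have D0 : Dc i ^+ q != 0 by apply/expf_neq0/Dc_neq0.
have b0 := bracket_neq0 i.
have -> : bracket d = bracket m ^+ (q ^ i.+1) + bracket i.
  rewrite !bracketE frobBX -exprM -expnD.
  have -> : (m.+1 + i.+1)%N = d.+1 by rewrite /m; lia.
  ring.
by field; rewrite L1 B1 D0 b0.
Qed.

Lemma eps_term_last d x :
  eps_term d.+1 d.+1 x = - (eps_term d d x ^+ q / Lc d ^+ q.-1).
Proof.
rewrite eps_term_frob /eps_term !subnn LcS /Lc big_ord0 !expr1n !mulr1 /= exprS.
have D0 : Dc d ^+ q != 0 by apply/expf_neq0/Dc_neq0.
have b0 := bracket_neq0 d.
by field; rewrite D0 b0.
Qed.

Lemma frob_sum (I : finType) (G : I -> C) : (\sum_i G i) ^+ q = \sum_i G i ^+ q.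
Proof.
apply: (big_morph _ (frobD inj)).
by rewrite expr0n (gtn_eqF (ltnW (card_gt1 F))).
Qed.

(** The recursion reads eps_(d+1) = eps_d - eps_d^q / L_d^(q-1). The q-th power shifts the index of
    the expansion by one; inner terms match by [eps_termS], and the two extreme terms are treated
    apart. *)
Lemma eps_expansion d x : eps d x = \sum_(i < d.+1) eps_term d i x.
Proof.
elim: d => [|d IH].
  by rewrite big_ord_recl big_ord0 addr0 eps_term0 /eps ev0 divr1.
have -> : eps d.+1 x = eps d x - eps d x ^+ q / Lc d ^+ q.-1.
  rewrite epsS Ed_eps; move: (eps d x) => e.
  by rewrite exprq !exprMn sign_pred exprVn; ring.
rewrite {2}IH frob_sum mulr_suml -sumrN.
rewrite [in RHS]big_ord_recl eps_term0 [in RHS]big_ord_recr /= /bump /= add1n.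
rewrite eps_term_last IH big_ord_recl eps_term0 big_ord_recr /= !addrA.
congr (_ + _); rewrite -addrA -big_split; congr (_ + _); apply: eq_bigr => i _.
by rewrite /bump /= add1n eps_termS.
Qed.

End CarlitzExpansion.

(** * Convergence to the Carlitz exponential *)

Section Limits.
Variables (C : fieldType) (R : realType) (nrm : C -> R).
Hypothesis nrmP : is_nonarch_abs nrm.
Implicit Types (u v : nat -> C) (l m : C).

Lemma cvgC_cst l : cvgC nrm (fun=> l) l.
Proof. by move=> e e0; exists 0%N => n _; rewrite subrr (nrm0 nrmP). Qed.

Lemma cvgCD u v l m : cvgC nrm u l -> cvgC nrm v m ->
  cvgC nrm (fun n => u n + v n) (l + m).
Proof.
move=> ul vm; apply: bcvg_cvgC.
by apply: (bcvgD nrmP); apply: bcvg_const.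
Qed.

Lemma cvgCM u v l m : cvgC nrm u l -> cvgC nrm v m ->
  cvgC nrm (fun n => u n * v n) (l * m).
Proof.
move=> ul vm; apply: bcvg_cvgC.
by apply: (bcvgM nrmP); apply: bcvg_const.
Qed.

Lemma cvgCX u l k : cvgC nrm u l -> cvgC nrm (fun n => u n ^+ k) (l ^+ k).
Proof.
move=> ul; elim: k => [|k IH]; first exact: cvgC_cst.
have -> : (fun n => u n ^+ k.+1) = (fun n => u n * u n ^+ k).
  by apply/funext => n; rewrite exprS.
by rewrite exprS; apply: cvgCM.
Qed.

Lemma cvgC_shift u l : cvgC nrm u l -> cvgC nrm (fun n => u n.+1) l.
Proof. by move=> ul e /ul[N h]; exists N => n Nn; apply/h/leqW. Qed.

Lemma cvgC_subn u l i : cvgC nrm u l -> cvgC nrm (fun n => u (n - i)%N) l.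
Proof.
move=> ul e /ul[N h]; exists (N + i)%N => n Nn; apply: h.
by rewrite -(addnK i N) leq_sub2r.
Qed.

Lemma cvgC_nrm u l (M : R) : cvgC nrm u l -> 0 < M -> (forall n, nrm (u n) = M) ->
  nrm l = M.
Proof.
move=> ul M0 uM; have [N /(_ N (leqnn _))] := ul _ M0.
move=> h; have := @nrmB_eq _ _ _ nrmP (u N) (u N - l).
by rewrite uM subKr; apply.
Qed.

(** Constancy of the norm keeps the sequence away from 0; it holds for both sequences to be
    inverted, [Uc] and [eps]. *)
Lemma cvgCV u l (M : R) : cvgC nrm u l -> 0 < M -> (forall n, nrm (u n) = M) ->
  cvgC nrm (fun n => (u n)^-1) l^-1.
Proof.
move=> ul M0 uM; have lM := cvgC_nrm ul M0 uM.
have l0 : l != 0 by rewrite -(nrm_gt0 nrmP) lM.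
have u0 n : u n != 0 by rewrite -(nrm_gt0 nrmP) uM.
move=> e e0; have [|N h] := ul (e * (M * M)); first by rewrite !mulr_gt0.
exists N => n Nn.
have -> : (u n)^-1 - l^-1 = - (u n - l) / (u n * l).
  by field; rewrite u0 l0.
rewrite (nrmM nrmP) (nrmV nrmP) (nrmN nrmP) (nrmM nrmP) uM lM.
by rewrite ltr_pdivrMr ?mulr_gt0 // h.
Qed.

Lemma bcvg_unshift (I : Type) (u : nat -> I -> C) (l : I -> C) :
  bcvg nrm (fun n => u n.+1) l -> bcvg nrm u l.
Proof.
move=> [ul b]; split=> // e /ul[N h]; exists N.+1 => -[|n] // Nn; exact: h.
Qed.

End Limits.

(** * Absolute values of the Carlitz quantities *)

Section CarlitzLimits.
Variables (F : finFieldType) (C : fieldType) (R : realType).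
Variables (inj : {rmorphism F -> C}) (theta : C) (nrm : C -> R).
Hypothesis CP : is_Cinfty inj theta nrm.
Local Notation q := #|F|.
Local Notation bracket := (bracket F theta).
Local Notation Dc := (Dc F theta).
Local Notation Ed := (Ed F theta).
Local Notation lc := (lc F theta).
Local Notation Lc := (Lc F theta).
Local Notation eps := (eps F theta).

Lemma Cinfty_nonarch : is_nonarch_abs nrm. Proof. by case: CP. Qed.
Let nrmP := Cinfty_nonarch.

Lemma Cinfty_complete (x : nat -> C) : cauchyC nrm x -> exists y, cvgC nrm x y.
Proof. by case: CP => _ _ h _ _; apply: h. Qed.
Let complete := Cinfty_complete.

Lemma nrm_theta_ge2 : 2 <= nrm theta.
Proof. by case: CP => _ -> _ _ _; rewrite (ler_nat _ 2) /qF card_gt1. Qed.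

Lemma theta_neq0 : theta != 0.
Proof. by rewrite -(nrm_gt0 nrmP); have := nrm_theta_ge2; lra. Qed.

Lemma nrm_thetaX_ge n : 2 ^+ n <= nrm (theta ^+ n).
Proof. by rewrite (nrmX nrmP) lerXn2r ?nnegrE ?(nrm_ge0 nrmP) ?nrm_theta_ge2. Qed.

Lemma ltn_expq j : (j < q ^ j)%N.
Proof. exact: ltn_expl (card_gt1 F). Qed.

Definition ratio j : C := theta / theta ^+ (q ^ j.+1).

Lemma nrm_ratio j : nrm (ratio j) <= 1 / 2 ^+ j.
Proof.
have h : (q ^ j.+1 = (q ^ j.+1).-1.+1)%N.
  by rewrite prednK // expn_gt0 (ltnW (card_gt1 F)).
rewrite /ratio h exprS invfM mulVKf ?theta_neq0 // (nrmV nrmP) div1r.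
rewrite lef_pV2 ?posrE ?exprn_gt0 //; last first.
  by apply: lt_le_trans (nrm_thetaX_ge _); rewrite exprn_gt0.
apply: le_trans (nrm_thetaX_ge _); rewrite ler_weXn2l ?ler1n //.
by have := ltn_expq j.+1; rewrite {1}h; lia.
Qed.

Lemma nrm_ratio_lt1 j : nrm (ratio j) < 1.
Proof.
have h : (q ^ j.+1 = (q ^ j.+1).-2.+2)%N.
  by have := ltn_expq j.+1; move: (q ^ j.+1)%N => [|[|]].
rewrite /ratio h exprS invfM mulVKf ?theta_neq0 // (nrmV nrmP).
rewrite invf_lt1; last by apply: lt_le_trans (nrm_thetaX_ge _); rewrite exprn_gt0.
by apply: lt_le_trans (nrm_thetaX_ge _); rewrite exprn_egt1 ?ltr1n.
Qed.

Lemma nrm_1ratio j : nrm (1 - ratio j) = 1.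
Proof. by rewrite (nrmB_eq nrmP) (nrm1 nrmP) // nrm_ratio_lt1. Qed.

Lemma ratio1_neq0 j : 1 - ratio j != 0.
Proof. by rewrite -(nrm_gt0 nrmP) nrm_1ratio ltr01. Qed.

Lemma bracket_ratio j : bracket j = theta ^+ (q ^ j.+1) * (1 - ratio j).
Proof.
rewrite bracketE mulrBr mulr1 /ratio mulrCA divff ?mulr1 //.
exact/expf_neq0/theta_neq0.
Qed.

Lemma nrm_bracket j : nrm (bracket j) = nrm (theta ^+ (q ^ j.+1)).
Proof. by rewrite bracket_ratio (nrmM nrmP) nrm_1ratio mulr1. Qed.

Lemma bracket_neq0 j : bracket j != 0.
Proof. by rewrite bracket_ratio mulf_neq0 ?ratio1_neq0 ?expf_neq0 ?theta_neq0. Qed.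

Lemma nrm_bracket_ge2 j : 2 <= nrm (bracket j).
Proof.
rewrite nrm_bracket; apply: le_trans (nrm_thetaX_ge _).
by rewrite -[leLHS]expr1 ler_weXn2l ?ler1n // expn_gt0 (ltnW (card_gt1 F)).
Qed.

(** Carries the size of L_d: L_d = V_d^q / U_d with |U_d| = 1 ([Lc_Uc]). *)
Definition Vc d : C := \prod_(i < d) theta ^+ (q ^ i).

Lemma VcS d : Vc d.+1 = Vc d * theta ^+ (q ^ d).
Proof. by rewrite /Vc big_ord_recr. Qed.

Lemma Vc_frob d : Vc d.+1 = theta * Vc d ^+ q.
Proof.
elim: d => [|d IH]; first by rewrite VcS /Vc big_ord0 expr1n mul1r mulr1 expr1.
by rewrite VcS {1}IH VcS exprMn -exprqS mulrA.
Qed.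

Lemma Vc_add d i : Vc (i + d) = Vc i * Vc d ^+ (q ^ i).
Proof.
elim: d => [|d IH]; first by rewrite addn0 /Vc big_ord0 expr1n mulr1.
by rewrite addnS !VcS IH exprMn mulrA -exprM -expnD addnC.
Qed.

Lemma Vc_neq0 d : Vc d != 0.
Proof. by apply/prodf_neq0 => i _; apply/expf_neq0/theta_neq0. Qed.

Lemma nrm_Vc_ge d : 2 ^+ d <= nrm (Vc d).
Proof.
elim: d => [|d IH]; first by rewrite /Vc big_ord0 (nrm1 nrmP) expr0.
rewrite VcS (nrmM nrmP) exprSr ler_pM ?exprn_ge0 //.
apply: le_trans (nrm_thetaX_ge _); rewrite -[leLHS]expr1 ler_weXn2l ?ler1n //.
by rewrite expn_gt0 (ltnW (card_gt1 F)).
Qed.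

(** Partial products of the infinite product in [pitilde]. *)
Definition Uc d : C := \prod_(i < d) (1 - ratio i)^-1.

Lemma UcS d : Uc d.+1 = Uc d / (1 - ratio d).
Proof. by rewrite /Uc big_ord_recr. Qed.

Lemma nrm_Uc d : nrm (Uc d) = 1.
Proof.
by rewrite (nrm_prod nrmP) big1 // => i _; rewrite (nrmV nrmP) nrm_1ratio invr1.
Qed.

Lemma Uc_neq0 d : Uc d != 0.
Proof. by rewrite -(nrm_gt0 nrmP) nrm_Uc ltr01. Qed.

Lemma Lc_Uc d : Lc d = Vc d ^+ q / Uc d.
Proof.
elim: d => [|d IH].
  by rewrite /Lc /Vc /Uc !big_ord0 expr1n divr1.
rewrite LcS IH UcS VcS exprMn -exprqS bracket_ratio.
have r0 := ratio1_neq0 d; have U0 := Uc_neq0 d.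
by field; rewrite r0 U0.
Qed.

Lemma nrm_Lc d : nrm (Lc d) = nrm (Vc d) ^+ q.
Proof. by rewrite Lc_Uc (nrmM nrmP) (nrmV nrmP) nrm_Uc invr1 mulr1 (nrmX nrmP). Qed.

Lemma Uc_cvg : cvgC nrm Uc (prodC nrm (fun j => (1 - ratio j)^-1)).
Proof.
have [|n _|l /(bcvg_pt tt) ul] :=
    @bcvg_tele _ _ _ nrmP unit complete (fun n _ => Uc n) 1 1.
- by move=> _; rewrite nrm_Uc.
- have -> : Uc n.+1 - Uc n = Uc n.+1 * ratio n.
    by rewrite UcS; have := ratio1_neq0 n => r0; field.
  by rewrite (nrmM nrmP) nrm_Uc mul1r nrm_ratio.
by rewrite /prodC (limC_eq nrmP ul).
Qed.

Definition Uinf : C := prodC nrm (fun j => (1 - ratio j)^-1).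

Lemma nrm_Uinf : nrm Uinf = 1.
Proof. exact (cvgC_nrm nrmP Uc_cvg ltr01 nrm_Uc). Qed.

Lemma pitildeE iota : pitilde F theta nrm iota = iota * theta * Uinf.
Proof. by []. Qed.

Lemma nrm_Dc_ge1 d : 1 <= nrm (Dc d).
Proof.
elim: d => [|d IH] /=; first by rewrite (nrm1 nrmP).
rewrite (nrmM nrmP) -[leLHS]mulr1 ler_pM //.
  by apply: le_trans (nrm_bracket_ge2 d); rewrite ler1n.
by rewrite (nrmX nrmP) exprn_ege1.
Qed.

Lemma nrm_Dc_ge2 d : 2 <= nrm (Dc d.+1).
Proof.
rewrite /= (nrmM nrmP) -[leLHS]mulr1 ler_pM ?nrm_bracket_ge2 //.
by rewrite (nrmX nrmP) exprn_ege1 ?nrm_Dc_ge1.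
Qed.

(** The factor 2 absorbs l_1 = -1; each later step multiplies by a power of some D_j with j >= 1, of
    norm at least 2. *)
Lemma nrm_lc_ge d : 2 ^+ d <= 2 * nrm (lc d).
Proof.
case: d => [|d]; first by rewrite /= (nrm1 nrmP) expr0 mulr1 ler1n.
elim: d => [|d IH].
  by rewrite /= expr1n mulr1 (nrmN nrmP) (nrm1 nrmP) mulr1 expr1.
have -> : lc d.+2 = - (Dc d.+1 ^+ q.-1 * lc d.+1) by [].
rewrite exprS (nrmN nrmP) (nrmM nrmP) mulrCA ler_pM ?exprn_ge0 // (nrmX nrmP).
have [k ->] : exists k, q.-1 = k.+1.
  by exists q.-2; have := card_gt1 F; case: #|F| => [|[]].
rewrite exprS -[leLHS]mulr1 ler_pM ?nrm_Dc_ge2 //.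
by rewrite exprn_ege1 ?nrm_Dc_ge1.
Qed.

Lemma nrm_lcV d : (nrm (lc d))^-1 <= 2 / 2 ^+ d.
Proof.
have l0 : 0 < nrm (lc d).
  by rewrite (nrm_gt0 nrmP) (lc_neq0 bracket_neq0).
have p0 : 0 < (2 : R) ^+ d by rewrite exprn_gt0.
rewrite ler_pdivlMr // -ler_pdivlMl ?invr_gt0 // invrK mulrC.
exact: nrm_lc_ge.
Qed.

Section UnitDisc.
Variable z : C.
Hypothesis z1 : nrm z < 1.

Lemma nrm_Ed d : nrm (Ed d z) = nrm (eps d z) / nrm (Vc d) ^+ q.
Proof.
rewrite Ed_eps 2!(nrmM nrmP) (nrmV nrmP) nrm_Lc (nrmX nrmP).
by rewrite (nrmN nrmP) (nrm1 nrmP) expr1n mul1r.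
Qed.

Lemma nrm_Vc_q d : 1 <= nrm (Vc d) ^+ q.
Proof.
rewrite exprn_ege1 //; apply: le_trans (nrm_Vc_ge d).
by rewrite exprn_ege1 ?ler1n.
Qed.

(** Each step of [epsS] multiplies by 1 - E_d(z)^(q-1), of norm 1 because |E_d(z)| < 1. *)
Lemma nrm_eps d : nrm (eps d z) = nrm z.
Proof.
elim: d => [|d IH]; first by rewrite eps0.
have E1 : nrm (Ed d z) < 1.
  rewrite nrm_Ed IH ltr_pdivrMr ?mul1r; first exact: lt_le_trans z1 (nrm_Vc_q d).
  exact: lt_le_trans ltr01 (nrm_Vc_q d).
rewrite (epsS bracket_neq0) -[X in X - _]mulr1 -mulrBr (nrmM nrmP) IH.
rewrite (nrmB_eq nrmP) (nrm1 nrmP) ?mulr1 // (nrmX nrmP).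
by rewrite exprn_ilt1 ?(nrm_ge0 nrmP) // -lt0n -subn1 subn_gt0 card_gt1.
Qed.

(** With U = U_(d-i) this is the i-th term of U_d eps_d(z), with U = [Uinf] that of e_C(pi z)/(iota
    theta): the passage to the limit affects U only. *)
Definition exp_term i (U : C) : C :=
  (-1) ^+ i * Vc i ^+ q / Dc i * U ^+ (q ^ i) * z ^+ (q ^ i).

Lemma Uc_eps d : Uc d * eps d z = \sum_(i < d.+1) exp_term i (Uc (d - i)).
Proof.
rewrite (eps_expansion inj bracket_neq0) mulr_sumr; apply: eq_bigr => i _.
rewrite /eps_term /exp_term !Lc_Uc expr_div_n.
have id : (i <= d)%N by rewrite -ltnS.
have -> : Vc d ^+ q = Vc i ^+ q * (Vc (d - i) ^+ q) ^+ (q ^ i).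
  by rewrite -{1}(subnKC id) Vc_add exprMn exprAC.
have V0 : (Vc (d - i) ^+ q) ^+ (q ^ i) != 0 by rewrite !expf_neq0 ?Vc_neq0.
have U1 : Uc (d - i) ^+ (q ^ i) != 0 by rewrite expf_neq0 ?Uc_neq0.
have U0 := Uc_neq0 d; have D0 := Dc_neq0 bracket_neq0 i.
by field; rewrite V0 U1 U0 D0.
Qed.

(** By [Dc_lc], |V_i^q / D_i| = |L_i / D_i| = 1/|l_i|, which decays geometrically. *)
Lemma nrm_exp_term i U : nrm U = 1 -> nrm (exp_term i U) <= 2 / 2 ^+ i.
Proof.
move=> U1; rewrite /exp_term.
have sgn : nrm ((-1) ^+ i) = 1 by rewrite (nrmX nrmP) (nrmN nrmP) (nrm1 nrmP) expr1n.
have E a b c e x : nrm (a * b / c * e * x) =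
    nrm a * (nrm b / nrm c) * nrm e * nrm x.
  by rewrite !(nrmM nrmP) (nrmV nrmP) mulrA.
have D a b c : nrm (a * b * c) = nrm a * nrm b * nrm c by rewrite !(nrmM nrmP).
rewrite E sgn mul1r !(nrmX nrmP) -nrm_Lc U1 expr1n mulr1 Dc_lc D sgn mul1r.
have L0 : nrm (Lc i) != 0.
  by rewrite (nrm_eq0 nrmP) Lc_neq0 // => j; apply: bracket_neq0.
rewrite invfM mulrCA divff // mulr1.
apply: le_trans (nrm_lcV i); rewrite -[leRHS]mulr1 ler_pM ?invr_ge0 ?exprn_ge0 //;
  rewrite ?(nrm_ge0 nrmP) //.
by rewrite exprn_ile1 ?(nrm_ge0 nrmP) // ltW.
Qed.

End UnitDisc.
End CarlitzLimits.

(** * The limit of the interpolation polynomials *)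

Section InterpolationLimit.
Variables (F : finFieldType) (C : fieldType) (R : realType).
Variables (inj : {rmorphism F -> C}) (theta : C) (nrm : C -> R).
Hypothesis CP : is_Cinfty inj theta nrm.
Local Notation q := #|F|.
Local Notation Ed := (Ed F theta).
Local Notation bt := (bt F theta).
Local Notation Psi := (Psi F theta).
Local Notation eps := (eps F theta).
Local Notation Vc := (Vc F theta).
Local Notation Uc := (Uc F theta).
Local Notation Uinf := (Uinf F theta nrm).
Local Notation exp_term := (exp_term F theta).
Let nrmP := Cinfty_nonarch CP.
Let complete := Cinfty_complete CP.
Let b_neq0 := bracket_neq0 CP.

Variable iota : C.
Hypothesis iotaP : iota ^+ q.-1 = - theta.
Local Notation pit := (pitilde F theta nrm iota).
Local Notation eC := (eC inj theta nrm).

Lemma iota_neq0 : iota != 0.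
Proof.
have q1 : (0 < q.-1)%N by rewrite -subn1 subn_gt0 card_gt1.
have := theta_neq0 CP; rewrite -oppr_eq0 -iotaP.
by rewrite expf_eq0 q1.
Qed.

Lemma iota_frob i : iota ^+ (q ^ i) = (-1) ^+ i * Vc i * iota.
Proof.
elim: i => [|i IH].
  by rewrite /Vc big_ord0 expr0 expr1 !mul1r.
rewrite exprqS IH !exprMn (frob_sign1 inj) (exprq F iota) iotaP Vc_frob exprS.
ring.
Qed.

(** Iterating iota^q = - theta iota gives the sign and V_i; then V_i theta^(q^i) = theta V_i^q
    produces the numerator of [exp_term]. *)
Lemma pit_frob i :
  pit ^+ (q ^ i) = iota * theta * ((-1) ^+ i * Vc i ^+ q * Uinf ^+ (q ^ i)).
Proof.
rewrite pitildeE !exprMn iota_frob.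
have -> : (-1) ^+ i * Vc i * iota * theta ^+ (q ^ i) =
  iota * ((-1) ^+ i * (Vc i * theta ^+ (q ^ i))) by ring.
by rewrite -VcS Vc_frob; ring.
Qed.

Section UnitDisc.
Variable z : C.
Hypothesis z1 : nrm z < 1.

(** Tannery's theorem allows the limit term by term in [Uc_eps]; [pit_frob] identifies the resulting
    series with that of e_C. *)
Lemma Uc_eps_cvg :
  cvgC nrm (fun d => Uc d * eps d z) (eC (pit * z) / (iota * theta)).
Proof.
have t0 : iota * theta != 0 by rewrite mulf_neq0 ?iota_neq0 ?(theta_neq0 CP).
have wA := nrm_exp_term CP z1.
have tan := @tannery _ _ _ nrmP (fun d i => exp_term z i (Uc (d - i)))
  (fun i => exp_term z i Uinf) 2 (ltW (ltr0Sn _ 1)).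
have {}tan := tan (fun d i _ => wA _ _ (nrm_Uc CP _)) (fun i => wA _ _ (nrm_Uinf CP)).
have {}tan : cvgC nrm (fun d => \sum_(i < d.+1) exp_term z i (Uc (d - i))
    - \sum_(i < d.+1) exp_term z i Uinf) 0.
  apply: tan => i; rewrite /exp_term.
  apply: (cvgCM nrmP (cvgCM nrmP (cvgC_cst nrmP _) _) (cvgC_cst nrmP _)).
  exact: (cvgCX nrmP _ (cvgC_subn i (Uc_cvg CP))).
have eE i : (pit * z) ^+ (qF F ^ i) / Dj inj theta i = iota * theta * exp_term z i Uinf.
  rewrite exprMn [pit ^+ _]pit_frob (DjE inj b_neq0) /exp_term; ring.
have : cvgC nrm (fun n => \sum_(i < n) (pit * z) ^+ (qF F ^ i) / Dj inj theta i)
    (eC (pit * z)).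
  apply: (sumC_cvg nrmP (A := nrm (iota * theta) * 2) complete) => n.
  by rewrite eE (nrmM nrmP) -mulrA ler_wpM2l ?(nrm_ge0 nrmP) ?wA ?(nrm_Uinf CP).
move=> /cvgC_shift/(cvgCM nrmP)/(_ (cvgC_cst nrmP (iota * theta)^-1)) h.
have := cvgCD nrmP tan h; rewrite add0r; congr (cvgC nrm _ _).
apply/funext => d; rewrite (Uc_eps CP).
have -> : \sum_(i < d.+1) (pit * z) ^+ (qF F ^ i) / Dj inj theta i
   = iota * theta * \sum_(i < d.+1) exp_term z i Uinf.
  by rewrite mulr_sumr; apply: eq_bigr => i _; rewrite eE.
by rewrite [iota * theta * _]mulrC mulfK // subrK.
Qed.

Lemma eps_cvg : cvgC nrm (fun d => eps d z) (eC (pit * z) / pit).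
Proof.
have h := cvgCM nrmP Uc_eps_cvg (cvgCV nrmP (Uc_cvg CP) ltr01 (nrm_Uc CP)).
have -> : eC (pit * z) / pit = eC (pit * z) / (iota * theta) / Uinf.
  by rewrite pitildeE invfM mulrA.
move: h; congr (cvgC nrm _ _); apply/funext => d.
by rewrite mulrC mulKf ?(Uc_neq0 CP).
Qed.

Lemma epsV_cvg : z != 0 -> cvgC nrm (fun d => (eps d z)^-1) (pit / eC (pit * z)).
Proof.
move=> z0; have -> : pit / eC (pit * z) = (eC (pit * z) / pit)^-1.
  by rewrite invfM invrK mulrC.
apply: (cvgCV nrmP eps_cvg) (nrm_eps CP z1).
by rewrite (nrm_gt0 nrmP).
Qed.

End UnitDisc.

Definition thinv j : C := (theta ^+ (q ^ j))^-1.

Lemma nrm_thinv_geo j : nrm (thinv j) <= 1 / 2 ^+ j.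
Proof.
rewrite /thinv (nrmV nrmP) div1r lef_pV2 ?posrE ?exprn_gt0 //; last first.
  by apply: lt_le_trans (nrm_thetaX_ge CP _); rewrite exprn_gt0.
apply: le_trans (nrm_thetaX_ge CP _); rewrite ler_weXn2l ?ler1n //.
exact/ltnW/ltn_expq.
Qed.

Lemma nrm_thinv_lt1 j : nrm (thinv j) < 1.
Proof.
rewrite /thinv (nrmV nrmP) invf_lt1; last first.
  by apply: lt_le_trans (nrm_thetaX_ge CP _); rewrite exprn_gt0.
apply: lt_le_trans (nrm_thetaX_ge CP _); rewrite exprn_egt1 ?ltr1n //.
by rewrite -lt0n expn_gt0 (ltnW (card_gt1 F)).
Qed.

Local Notation beta := (linprod thinv).

(** Splits off the unbounded scalar of b_d; what remains converges to iota/omega. *)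
Lemma bt_beta d : bt d = ((-1) ^+ d * Vc d)%:P * beta d.
Proof.
elim: d => [|d IH].
  by rewrite /bt /linprod /Vc !big_ord0 expr0 !mulr1.
rewrite btS IH linprodS VcS exprS -!mulrA.
have -> : 'X - (theta ^+ (q ^ d))%:P =
    (- theta ^+ (q ^ d))%:P * (1 - (thinv d)%:P * 'X).
  rewrite mulrBr mulr1 mulrA -polyCM mulNr divff ?expf_neq0 ?(theta_neq0 CP) //.
  by rewrite !polyCN polyC1; ring.
by rewrite !polyCM !polyCN polyC1; ring.
Qed.

(** The scalar in E_d b_d = kappa_d beta_d, namely (-1)^d V_d E_d(z) ([kappaE]), written so that its
    decay through V_d/V_d^q is visible. *)
Definition kappa d z : C := eps d z * Uc d * (Vc d / Vc d ^+ q).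

Lemma kappaE d z : (-1) ^+ d * Vc d * Ed d z = kappa d z.
Proof.
rewrite Ed_eps (Lc_Uc CP) /kappa invfM invrK.
have -> : (-1) ^+ d * Vc d * ((-1) ^+ d * eps d z * ((Vc d ^+ q)^-1 * Uc d)) =
  ((-1) ^+ d * (-1) ^+ d) * (eps d z * Uc d * (Vc d / Vc d ^+ q)) by ring.
by rewrite -exprD addnn -mul2n exprM sqrrN expr1n expr1n mul1r.
Qed.

Lemma nrm_kappa d z : nrm z < 1 -> nrm (kappa d z) <= nrm z / 2 ^+ d.
Proof.
move=> z1; rewrite /kappa 2!(nrmM nrmP) (nrm_eps CP z1) (nrmM nrmP) (nrm_Uc CP) mulr1.
rewrite ler_wpM2l ?(nrm_ge0 nrmP) // (nrmV nrmP) (nrmX nrmP).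
have V2 := nrm_Vc_ge CP d; have p0 : 0 < (2 : R) ^+ d by rewrite exprn_gt0.
have V0 : 0 < nrm (Vc d) by apply: lt_le_trans V2.
have [k ->] : exists k, q = k.+2.
  by exists q.-2; have := card_gt1 F; case: #|F| => [|[]].
rewrite exprS invfM mulVKf ?gt_eqF // lef_pV2 ?posrE ?exprn_gt0 //.
apply: le_trans V2 _; rewrite exprS -[leLHS]mulr1 ler_pM2l //.
rewrite exprn_ege1 //; apply: le_trans (nrm_Vc_ge CP d); by rewrite exprn_ege1 ?ler1n.
Qed.

Lemma Ed_bt_coef d z k : (Ed d z *: bt d)`_k = kappa d z * (beta d)`_k.
Proof. by rewrite bt_beta coefZ coefCM mulrA [Ed d z * _]mulrC kappaE. Qed.

(** V_(d+1) = theta V_d^q exactly compensates the decay of [kappa], so this term of [Psi_mulX]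
    survives in the limit and produces e_C. *)
Lemma Ed_btS_coef d z k :
  (Ed d z *: bt d.+1)`_k = - theta * (Uc d * eps d z) * (beta d.+1)`_k.
Proof.
rewrite bt_beta coefZ coefCM mulrA; congr (_ * _).
have -> : Ed d z * ((-1) ^+ d.+1 * Vc d.+1) =
    - theta * (Vc d ^+ q / Vc d) * ((-1) ^+ d * Vc d * Ed d z).
  by rewrite Vc_frob exprS; have := Vc_neq0 CP d => V0; field.
rewrite kappaE /kappa.
have V0 := Vc_neq0 CP d; have V1 : Vc d ^+ q != 0 by rewrite expf_neq0.
by field; rewrite V0 V1.
Qed.

Lemma beta_cvg : exists B, bcvg nrm (fun n k => (beta n)`_k) B.
Proof. exact (linprod_cvg nrmP complete nrm_thinv_lt1 nrm_thinv_geo). Qed.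

Lemma nrm_beta n k : nrm (beta n)`_k <= 1.
Proof. exact (nrm_linprod_le1 nrmP nrm_thinv_lt1 n k). Qed.

(** The bound |z|, rather than a constant, provides the Lipschitz estimate at 0. *)
Lemma nrm_Psi d z k : nrm z < 1 -> nrm (Psi d z)`_k <= nrm z.
Proof.
move=> z1; rewrite /Psi coef_sum; apply: (nrm_sum_le nrmP).
  exact: nrm_ge0 nrmP _.
move=> i _; rewrite Ed_bt_coef (nrmM nrmP) -[leRHS]mulr1.
rewrite ler_pM ?(nrm_ge0 nrmP) ?nrm_beta //.
apply: le_trans (nrm_kappa _ z1) _.
rewrite ler_pdivrMr ?exprn_gt0 // -[leLHS]mulr1 ler_wpM2l ?(nrm_ge0 nrmP) //.
by rewrite exprn_ege1 ?ler1n.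
Qed.

Definition Psi_lim z : ser1 C := fun k => limC nrm (fun d => (Psi d z)`_k).

Lemma Psi_cvg z : nrm z < 1 -> bcvg nrm (fun d k => (Psi d z)`_k) (Psi_lim z).
Proof.
move=> z1.
have [k|d k|l ul] := bcvg_tele nrmP complete (u := fun d k => (Psi d z)`_k)
   (A := nrm z) (M := 0).
- by rewrite /Psi big_ord0 coef0 (nrm0 nrmP).
- rewrite PsiS coefD addrAC subrr add0r Ed_bt_coef (nrmM nrmP) -[leRHS]mulr1.
  by rewrite ler_pM ?(nrm_ge0 nrmP) ?nrm_beta ?nrm_kappa.
suff -> : Psi_lim z = l by [].
by apply/funext => k; apply: (limC_eq nrmP); apply: (bcvg_pt k ul).
Qed.

Lemma nrm_Psi_lim z k : nrm z < 1 -> nrm (Psi_lim z k) <= nrm z.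
Proof.
move=> z1; apply: (nrm_lim_le nrmP (Psi_cvg z1)) => d.
exact: nrm_Psi.
Qed.

Section Omega.
Variable B : ser1 C.
Hypothesis BP : bcvg nrm (fun n k => (beta n)`_k) B.

Lemma inv_omega : inv1 nrm (omega F theta nrm iota) = scale1 iota^-1 B.
Proof.
exact (inv1_infprod nrmP complete nrm_thinv_lt1 nrm_thinv_geo iota_neq0 BP).
Qed.

Lemma Psi_lim_mulX w k : nrm w < 1 -> nrm (theta * w) < 1 ->
  Psi_lim (theta * w) k =
  (if k is j.+1 then Psi_lim w j else 0) + eC (pit * w) * (iota^-1 * B k).
Proof.
move=> w1 tw1.
apply: (cvgC_unique nrmP (cvgC_shift (bcvg_pt k (Psi_cvg tw1)))).
have h : cvgC nrm (fun d => theta * (Uc d * eps d w) * (beta d.+1)`_k)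
    (theta * (eC (pit * w) / (iota * theta)) * B k).
  apply: (cvgCM nrmP (cvgCM nrmP (cvgC_cst nrmP _) (Uc_eps_cvg w1))).
  exact: cvgC_shift (bcvg_pt k BP).
have -> : eC (pit * w) * (iota^-1 * B k) =
    theta * (eC (pit * w) / (iota * theta)) * B k.
  have i0 := iota_neq0; have t0 := theta_neq0 CP.
  by field; rewrite i0 t0.
have g : cvgC nrm (fun d => (Psi d.+1 w * 'X)`_k)
    (if k is j.+1 then Psi_lim w j else 0).
  case: k {h} => [|k].
    move=> e e0; exists 0%N => n _.
    by rewrite coefMX /= subrr (nrm0 nrmP).
  have := cvgC_shift (bcvg_pt k (Psi_cvg w1)); congr (cvgC nrm _ _).
  by apply/funext => d; rewrite coefMX.
have := cvgCD nrmP g h; congr (cvgC nrm _ _); apply/funext => d.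
by rewrite (Psi_mulX inj b_neq0) coefB Ed_btS_coef !mulNr opprK.
Qed.

(** The functional equation at z/theta reduces coefficient k at z to coefficient k-1 at z/theta,
    still in the disc; unrolling it gives the convolution of f_C(pi z) with 1/omega. *)
Lemma Psi_lim_fC z : nrm z < 1 ->
  Psi_lim z = fC_over_omega inj theta nrm iota z.
Proof.
move=> z1; apply/funext => k; rewrite /fC_over_omega inv_omega.
have t0 := theta_neq0 CP.
have dv w : nrm w < 1 -> nrm (w / theta) < 1.
  move=> w1; rewrite (nrmM nrmP) (nrmV nrmP) ltr_pdivrMr ?(nrm_gt0 nrmP) // mul1r.
  by have := nrm_theta_ge2 CP; lra.
have rec w j : nrm w < 1 -> Psi_lim w j =
    (if j is i.+1 then Psi_lim (w / theta) i else 0)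
    + eC (pit * (w / theta)) * (iota^-1 * B j).
  move=> w1; have tw : theta * (w / theta) = w by rewrite mulrCA divff ?mulr1.
  by rewrite -{1}tw Psi_lim_mulX ?tw // dv.
rewrite /mul1 /fC /scale1; elim: k z z1 => [|k IH] z z1; rewrite rec //.
  by rewrite big_ord_recl big_ord0 add0r addr0 subn0 expr1 mulrA.
rewrite big_ord_recl subn0 expr1 mulrA addrC; congr (_ + _).
rewrite IH ?dv //; apply: eq_bigr => i _.
rewrite subSS; congr (_ * _); congr eC.
by rewrite [in RHS]exprS invfM !mulrA.
Qed.

End Omega.
End InterpolationLimit.

(** * The limit of the partial sums *)

Section PartialSums.
Variables (F : finFieldType) (C : fieldType) (R : realType).
Variables (inj : {rmorphism F -> C}) (theta : C) (nrm : C -> R).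
Hypothesis CP : is_Cinfty inj theta nrm.
Local Notation q := #|F|.
Local Notation ed := (ed F theta).
Local Notation Dc := (Dc F theta).
Local Notation Ed := (Ed F theta).
Local Notation lc := (lc F theta).
Local Notation bt := (bt F theta).
Local Notation Psi := (Psi F theta).
Local Notation eps := (eps F theta).
Local Notation Vc := (Vc F theta).
Local Notation Uc := (Uc F theta).
Local Notation Uinf := (Uinf F theta nrm).
Let nrmP := Cinfty_nonarch CP.
Let complete := Cinfty_complete CP.
Let b_neq0 := bracket_neq0 CP.

Variable iota : C.
Hypothesis iotaP : iota ^+ q.-1 = - theta.
Local Notation pit := (pitilde F theta nrm iota).
Local Notation eC := (eC inj theta nrm).

Local Notation beta := (linprod (thinv F theta)).
Local Notation kappa := (kappa F theta).
Local Notation Psi_lim := (Psi_lim F theta nrm).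
Section FixedArity.
Variable s : nat.
Hypothesis s_le : (s <= 2 * q.-1)%N.
Local Notation L := (@lhs_partial F C inj theta s).
Local Notation rhs1 := (rhs1 inj theta nrm s iota).
Local Notation rhs2 := (rhs2 inj theta nrm s iota).

(** With m the exponent of E_d, there are m + q factors b_d, each contributing (-1)^d V_d. Of these
    scalars, m turn E_d^m into kappa_d^m and q turn l_(d+1)/D_d^q into -U_d. *)
Lemma correction_term d (b : 'I_s -> nat) z (al : {ffun 'I_s -> bool}) :
  (ones al + q <= s)%N ->
  lc d.+1 / Dc d ^+ q *
    ((\prod_i (if al i then (Psi d z)`_(b i) else (bt d)`_(b i)))
     * Ed d z ^+ (s - (ones al + q))) =
  - (Uc d * kappa d z ^+ (s - (ones al + q)) *
    \prod_i (if al i then (Psi d z)`_(b i) else (beta d)`_(b i))).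
Proof.
move=> h; set m := (s - (ones al + q))%N.
set P := \prod_i (if al i then (Psi d z)`_(b i) else (beta d)`_(b i)).
pose x := (-1) ^+ d * Vc d.
have -> : \prod_i (if al i then (Psi d z)`_(b i) else (bt d)`_(b i)) =
    x ^+ m * x ^+ q * P.
  rewrite -exprD; have -> : (m + q = s - ones al)%N by rewrite /m; lia.
  rewrite -prod_pick -big_split; apply: eq_bigr => i _.
  by case: (al i); rewrite /= ?mul1r // (bt_beta CP) coefCM.
have -> : lc d.+1 / Dc d ^+ q * (x ^+ m * x ^+ q * P * Ed d z ^+ m) =
    lc d.+1 / Dc d ^+ q * x ^+ q * (x * Ed d z) ^+ m * P.
  rewrite [(x * Ed d z) ^+ m]exprMn.
  by move: (x ^+ m) (x ^+ q) (Ed d z ^+ m) => *; ring.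
rewrite [x * Ed d z](kappaE CP) -mulNr -mulNr; congr (_ * _ * _).
have D0 := Dc_neq0 b_neq0 d; have l0 := lc_neq0 b_neq0 d.
have V0 : Vc d ^+ q != 0 by rewrite expf_neq0 ?(Vc_neq0 CP).
have -> : lc d.+1 = - (Dc d ^+ q.-1 * lc d) by [].
have -> : x ^+ q = (-1) ^+ d * Vc d ^+ q by rewrite exprMn (frob_sign1 inj).
have Dq : Dc d ^+ q.-1 != 0 by rewrite expf_neq0.
have -> : Dc d ^+ q = Dc d ^+ q.-1 * Dc d by rewrite exprq mulrC.
have s0 : (-1 : C) ^+ d != 0 by rewrite signr_eq0.
have -> : Dc d = (-1) ^+ d * lc d * (Vc d ^+ q / Uc d) by rewrite -(Lc_Uc CP) -Dc_lc.
have U0 := Uc_neq0 CP d.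
have Dq' : ((-1) ^+ d * lc d * (Vc d ^+ q / Uc d)) ^+ q.-1 != 0.
  by rewrite -(Lc_Uc CP) -Dc_lc.
move: Dq'; move: (_ ^+ q.-1) => y y0.
by field; rewrite y0 U0 V0 l0 s0.
Qed.

(** In the limit the indicator of m = 0 selects the [al] with exactly s - q ones. *)
Lemma kappa_cvg z m : nrm z < 1 ->
  cvgC nrm (fun d => kappa d z ^+ m) (m == 0%N)%:R.
Proof.
move=> z1; have k0 : cvgC nrm (fun d => kappa d z) 0.
  apply: (cvgC_geo (A := nrm z)) => d.
  by rewrite subr0 (nrm_kappa CP).
have := cvgCX nrmP m k0; rewrite expr0n; exact.
Qed.

(** The q factors 1/omega contribute iota^(-q), and pitilde iota^(-q) = theta Uinf / iota^(q-1) = -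
    Uinf. *)
Lemma rhs2E z B b : nrm z < 1 -> bcvg nrm (fun n k => (beta n)`_k) B ->
  rhs2 z b = - \sum_(al : {ffun 'I_s -> bool} | (ones al + q <= s)%N)
    (Uinf * ((s - (ones al + q))%N == 0%N)%:R *
     \prod_i (if al i then Psi_lim z (b i) else B (b i))).
Proof.
move=> z1 BP; rewrite /Defs.rhs2 -sumrN [LHS]big_mkcond [RHS]big_mkcond.
apply: eq_bigr => al _; rewrite -/(ones al) /qF.
have [h|h] := eqVneq (ones al + q)%N s; last first.
  case: leqP => // h'; have -> : (s - (ones al + q) == 0)%N = false.
    by apply/negbTE; rewrite subn_eq0 -ltnNge ltn_neqAle h.
  by rewrite mulr0 mul0r oppr0.
rewrite h leqnn subnn eqxx mulr1.
have i0 := iota_neq0 CP iotaP; have t0 := theta_neq0 CP.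
have -> : \prod_i (if al i then fC_over_omega inj theta nrm iota z (b i)
      else inv1 nrm (omega F theta nrm iota) (b i)) =
    iota^-1 ^+ q * \prod_i (if al i then Psi_lim z (b i) else B (b i)).
  have <- : (s - ones al = q)%N.
    by apply/eqP; rewrite -(eqn_add2l (ones al)) subnKC ?ones_le ?h.
  rewrite -prod_pick -big_split; apply: eq_bigr => i _.
  rewrite -(Psi_lim_fC CP iotaP BP z1) (inv_omega CP iotaP BP).
  by case: (al i) => /=; rewrite ?mul1r.
rewrite mulrA -mulNr; congr (_ * _).
rewrite exprVn exprq iotaP pitildeE.
by field; rewrite oppr_eq0 t0.
Qed.

Lemma lhs_cvg z : nrm z < 1 -> z != 0 ->
  bcvg nrm (L z) (fun b => rhs1 z b - rhs2 z b).
Proof.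
move=> z1 z0; have [B BP] := beta_cvg CP.
(* The identity at finite level concerns deg a < d + 1. *)
apply: bcvg_unshift; have PP := Psi_cvg CP z1.
have main : bcvg nrm
   (fun d (b : mon s) => (eps d.+1 z)^-1 * \prod_i (Psi d.+1 z)`_(b i))
   (fun b => pit / eC (pit * z) * \prod_i Psi_lim z (b i)).
  apply: (bcvgM nrmP).
    apply: bcvg_const; apply: (cvgC_shift (u := fun d => (eps d z)^-1)).
    exact: (epsV_cvg CP iotaP z1 z0).
  apply: (bcvg_prod nrmP) => i _.
  apply: (bcvg_comp (fun b : mon s => b i) (u := fun d k => (Psi d.+1 z)`_k)).
  exact: (bcvg_shift PP).
have corr : bcvg nrm
   (fun d (b : mon s) => \sum_(al : {ffun 'I_s -> bool} | (ones al + q <= s)%N)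
     Uc d * kappa d z ^+ (s - (ones al + q)) *
      \prod_i (if al i then (Psi d z)`_(b i) else (beta d)`_(b i)))
   (fun b => \sum_(al : {ffun 'I_s -> bool} | (ones al + q <= s)%N)
     Uinf * ((s - (ones al + q))%N == 0%N)%:R *
     \prod_i (if al i then Psi_lim z (b i) else B (b i))).
  apply: (bcvg_sum nrmP) => al _; apply: (bcvgM nrmP).
    apply: bcvg_const; apply: (cvgCM nrmP); first exact: (Uc_cvg CP).
    exact: kappa_cvg.
  apply: (bcvg_prod nrmP) => i _; case: (al i).
    exact: (bcvg_comp (fun b : mon s => b i) PP).
  exact: (bcvg_comp (fun b : mon s => b i) BP).
apply: bcvg_ext (bcvgD nrmP main corr) => [d b|b]; last first.
  rewrite (rhs2E b z1 BP) opprK; congr (_ * _ + _).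
  by apply: eq_bigr => i _; rewrite (Psi_lim_fC CP iotaP BP z1).
rewrite /lhs_partial; symmetry.
(* By [nrm_eps], 0 is the only zero of e_(d+1) in the disc. *)
have ez : (ed d.+1).[z] != 0.
  apply: contraNneq z0 => e0; have := nrm_eps CP z1 d.+1.
  by rewrite /eps e0 mul0r (nrm0 nrmP) => /esym/eqP; rewrite (nrm_eq0 nrmP).
rewrite (finite_identity inj b_neq0 b s_le ez) /eps invf_div; congr (_ + _).
rewrite mulr_sumr -sumrN; apply: eq_bigr => al h.
by rewrite correction_term // opprK.
Qed.

(** * Uniform Lipschitz estimates and the case [z = 0] *)

Lemma nrm_inj_le1 c : nrm (inj c) <= 1.
Proof.
have [->|c0] := eqVneq c 0; first by rewrite rmorph0 (nrm0 nrmP).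
rewrite (nrm_unity nrmP (n := q.-1)) //.
  by rewrite -subn1 subn_gt0 card_gt1.
have i0 : inj c != 0 by rewrite fmorph_eq0.
by apply: (mulfI i0); rewrite -exprq (inj_frob inj) mulr1.
Qed.

(** An a with |a| < 1 satisfies |eps_d(a)| = |a|, while e_d(a) = 0. *)
Lemma evalA_ge1 d (c : {ffun 'I_d -> F}) :
  evalA inj theta (polyA c) != 0 -> 1 <= nrm (evalA inj theta (polyA c)).
Proof.
rewrite -(nrm_gt0 nrmP) => a0; rewrite leNgt; apply/negP => a1.
have := nrm_eps CP a1 d; rewrite /eps (ev_evalA inj) mul0r (nrm0 nrmP) => e.
by rewrite -e ltxx in a0.
Qed.

(* The term [a = 0] of the sum vanishes as soon as [s > 0], whence the case [w = 0]. *)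
Lemma lhs_numerator d (b : mon s) (c : {ffun 'I_d -> F}) : (0 < s)%N ->
  inj (\prod_(i : 'I_s) (polyA c)`_(b i)) = 0 \/
  1 <= nrm (evalA inj theta (polyA c)).
Proof.
move=> s0; have [a0|a0] := eqVneq (evalA inj theta (polyA c)) 0; last first.
  by right; apply: evalA_ge1.
left; rewrite rmorph_prod (bigD1 (Ordinal s0)) //=.
by rewrite -(Psi_evalA inj b_neq0) a0 (Psi0 inj) coef0 mul0r.
Qed.

Lemma nrm_lhs0_le1 d (b : mon s) : (0 < s)%N -> nrm (L 0 d b) <= 1.
Proof.
move=> s0; apply: (nrm_sum_le nrmP) => // c _; rewrite sub0r.
have [->|a1] := lhs_numerator b c s0.
  by rewrite mul0r (nrm0 nrmP).
rewrite (nrmM nrmP) (nrmV nrmP) (nrmN nrmP) ler_pdivrMr ?mul1r.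
  exact: le_trans (nrm_inj_le1 _) a1.
exact: lt_le_trans a1.
Qed.

(** For |a| >= 1 > |w| one has |w - a| = |a|, so 1/(w - a) and -1/a differ by at most |w|, uniformly
    in [d] and [b]. *)
Lemma lhs_partial_lip d (b : mon s) w : (0 < s)%N -> nrm w < 1 ->
  nrm (L w d b - L 0 d b) <= nrm w.
Proof.
move=> s0 w1; rewrite /lhs_partial -sumrB; apply: (nrm_sum_le nrmP).
  exact: nrm_ge0 nrmP _.
move=> c _; have := lhs_numerator b c s0; set a := evalA inj theta (polyA c).
set x := inj _; have x1 : nrm x <= 1 by apply: nrm_inj_le1.
case=> [->|a1]; first by rewrite !mul0r subrr (nrm0 nrmP) (nrm_ge0 nrmP).
have a0 : a != 0 by rewrite -(nrm_gt0 nrmP); apply: lt_le_trans a1.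
have wa : nrm (w - a) = nrm a.
  by rewrite (nrmBC nrmP) (nrmB_eq nrmP) //; apply: lt_le_trans a1.
have wa0 : w - a != 0 by rewrite -(nrm_gt0 nrmP) wa (nrm_gt0 nrmP).
have -> : x / (w - a) - x / (0 - a) = x * w / ((w - a) * a).
  rewrite sub0r invrN mulrN opprK; field; by rewrite wa0 a0.
clearbody a x; rewrite !(nrmM nrmP) (nrmV nrmP) (nrmM nrmP) wa.
rewrite ler_pdivrMr ?mulr_gt0 ?(nrm_gt0 nrmP) //.
rewrite [leLHS]mulrC ler_wpM2l ?(nrm_ge0 nrmP) //; apply: le_trans x1 _.
by rewrite -[leLHS]mulr1 ler_pM.
Qed.

Lemma small_point (del : R) : 0 < del -> exists w, [/\ w != 0, nrm w < 1 & nrm w < del].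
Proof.
move=> d0; have [|N h] := geo_small 1 (_ : 0 < Num.min 1 del).
  by rewrite lt_min ltr01.
exists (theta ^- N).
have : nrm (theta ^- N) < Num.min 1 del.
  apply: le_lt_trans (h _ (leqnn _)); rewrite (nrmV nrmP) div1r.
  rewrite lef_pV2 ?posrE ?exprn_gt0 ?(nrm_thetaX_ge CP) //.
  by apply: lt_le_trans (nrm_thetaX_ge CP _); rewrite exprn_gt0.
rewrite lt_min => /andP[w1 wd]; split=> //.
by rewrite invr_neq0 ?expf_neq0 ?(theta_neq0 CP).
Qed.

(** The partial sums at 0 stay within e of those at a nonzero w with |w| < e, whose convergence is
    known; hence they are uniformly Cauchy. *)
Lemma lhs0_cvg : (0 < s)%N -> exists l, bcvg nrm (L 0) l.
Proof.
move=> s0; apply: (bcvg_cauchy nrmP complete (M := 1)) => [n b|e e0].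
  exact: nrm_lhs0_le1.
have [w [w0 w1 we]] := small_point e0.
have [h _] := lhs_cvg w1 w0; have [N hN] := h _ e0.
have lip n b : nrm (L 0 n b - L w n b) < e.
  rewrite (nrmBC nrmP); exact: le_lt_trans (lhs_partial_lip _ _ s0 w1) we.
exists N => n k Nn Nk b; apply: (nrm_chain nrmP (lip n b)).
apply: (nrm_chain nrmP (hN n Nn b)).
rewrite (nrmBC nrmP); apply: (nrm_chain nrmP (lip k b)); exact: hN.
Qed.

Lemma prod_lip (J : Type) (r : seq J) (f g : J -> C) (e : R) :
  (forall j, nrm (f j) <= 1) -> (forall j, nrm (g j) <= 1) ->
  (forall j, nrm (f j - g j) <= e) -> 0 <= e ->
  nrm (\prod_(j <- r) f j - \prod_(j <- r) g j) <= e.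
Proof.
move=> f1 g1 fg e0; elim: r => [|j r IH].
  by rewrite !big_nil subrr (nrm0 nrmP).
rewrite !big_cons; set p := \prod_(_ <- r) f _; set p' := \prod_(_ <- r) g _.
have -> : f j * p - g j * p' = f j * (p - p') + (f j - g j) * p' by ring.
have p1 : nrm p' <= 1.
  rewrite /p'; elim/big_ind: _ => [|x y x1 y1|//]; first by rewrite (nrm1 nrmP).
  by rewrite (nrmM nrmP) -[leRHS]mulr1 ler_pM ?(nrm_ge0 nrmP).
apply: (nrmD_le nrmP); rewrite (nrmM nrmP).
  by rewrite -[leRHS]mul1r ler_pM ?(nrm_ge0 nrmP).
by rewrite -[leRHS]mulr1 ler_pM ?(nrm_ge0 nrmP).
Qed.

Lemma rhs2_lip w b : nrm w < 1 -> nrm (rhs2 w b - rhs2 0 b) <= nrm w.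
Proof.
move=> w1; have [B BP] := beta_cvg CP.
have z1 : nrm (0 : C) < 1 by rewrite (nrm0 nrmP).
have B1 k : nrm (B k) <= 1.
  by apply: (nrm_lim_le nrmP BP) => n; apply: (nrm_beta CP).
have P1 x k : nrm x < 1 -> nrm (Psi_lim x k) <= 1.
  by move=> x1; apply: le_trans (nrm_Psi_lim CP k x1) (ltW x1).
rewrite !(rhs2E b _ BP) // -opprD (nrmN nrmP) -sumrB.
apply: (nrm_sum_le nrmP) => [|al _]; first exact: nrm_ge0 nrmP _.
rewrite -mulrBr (nrmM nrmP) -[leRHS]mul1r ler_pM ?(nrm_ge0 nrmP) //.
  rewrite (nrmM nrmP) (nrm_Uinf CP) mul1r; case: eqP => _;
    by rewrite ?(nrm1 nrmP) ?(nrm0 nrmP).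
apply: prod_lip => [i|i|i|]; last exact: nrm_ge0 nrmP _.
- by case: (al i); rewrite ?P1.
- by case: (al i); rewrite ?P1.
case: (al i); last by rewrite subrr (nrm0 nrmP) (nrm_ge0 nrmP).
apply: (nrmB_le nrmP); first exact: (nrm_Psi_lim CP).
by apply: le_trans (nrm_Psi_lim CP _ z1) _; rewrite (nrm0 nrmP) (nrm_ge0 nrmP).
Qed.

(** For w nonzero, [rhs1] is the limit of the partial sums at w plus [rhs2], and both change by at
    most |w| between w and 0. *)
Lemma rhs1_cvg0 l : (0 < s)%N -> bcvg nrm (L 0) l ->
  ext0 nrm rhs1 0 = (fun b => l b + rhs2 0 b).
Proof.
move=> s0 Ll; rewrite /ext0 eqxx /=.
pose P (m : ser C s) := forall e : R, 0 < e -> exists2 del : R, 0 < del &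
  forall w, w != 0 -> nrm w < del -> forall b, nrm (rhs1 w b - m b) < e.
have Pl : P (fun b => l b + rhs2 0 b).
  move=> e e0; exists (Num.min 1 e); first by rewrite lt_min ltr01.
  move=> w w0; rewrite lt_min => /andP[w1 we] b.
  have [/(_ _ e0)[N hN] _] := lhs_cvg w1 w0.
  have [/(_ _ e0)[N' hN'] _] := Ll.
  set n := maxn N N'.
  have -> : rhs1 w b - (l b + rhs2 0 b) =
    - (L w n b - (rhs1 w b - rhs2 w b)) + (L w n b - L 0 n b)
    + (L 0 n b - l b) + (rhs2 w b - rhs2 0 b) by ring.
  apply: (nrmD_lt nrmP); last exact: le_lt_trans (rhs2_lip _ w1) we.
  apply: (nrmD_lt nrmP); last exact: hN' (leq_maxr _ _) b.
  apply: (nrmD_lt nrmP); last exact: le_lt_trans (lhs_partial_lip _ _ s0 w1) we.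
  rewrite (nrmN nrmP); exact: hN (leq_maxl _ _) b.
have : P (ClassicalEpsilon.epsilon (inhabits (fun _ => 0)) P).
  by apply: ClassicalEpsilon.epsilon_spec; exists (fun b => l b + rhs2 0 b).
move: (ClassicalEpsilon.epsilon _ _) => m Pm; apply/funext => b.
(* The extension is unique: both candidates are within e of [rhs1 w b] for a suitable nonzero w near
   0, supplied by [small_point]. *)
apply: (cvgC_unique nrmP (u := fun=> m b) (cvgC_cst nrmP _)) => e e0.
exists 0%N => _ _; have [d1 d10 h1] := Pm _ e0; have [d2 d20 h2] := Pl _ e0.
have [|w [w0 _]] := @small_point (Num.min d1 d2).
  by rewrite lt_min d10.
rewrite lt_min => /andP[w1 w2]; apply: (nrm_chain nrmP (y := rhs1 w b)).
  by rewrite (nrmBC nrmP) h1.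
exact: h2.
Qed.

End FixedArity.
End PartialSums.

Theorem theorem1p1 (F : finFieldType) (C : fieldType) (R : realType)
    (inj : {rmorphism F -> C}) (theta : C) (nrm : C -> R)
    (iota : C) (s : nat) (z : C) :
  is_Cinfty inj theta nrm ->
  iota ^+ (#|F|.-1) = - theta ->
  (1 <= s <= 2 * (#|F|.-1))%N ->
  nrm z < 1 ->
  carlitz_lhs inj theta nrm s z =
    (fun b => ext0 nrm (rhs1 inj theta nrm s iota) z b - rhs2 inj theta nrm s iota z b).
Proof.
move=> CP iotaP /andP[s0 s_le] z1; have nrmP := Cinfty_nonarch CP.
have [->|z0] := eqVneq z 0; last first.
  rewrite /carlitz_lhs (limT_eq nrmP (lhs_cvg CP iotaP s_le z1 z0)).
  by rewrite /ext0 z0.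
have [l Ll] := lhs0_cvg CP iotaP s_le s0.
rewrite /carlitz_lhs (limT_eq nrmP Ll) (rhs1_cvg0 CP iotaP s_le s0 Ll).
by apply/funext => b; rewrite addrK.
Qed.
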